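(* The tropical reductive groups associated to the root data of $\mathrm{SL}_n$, $\mathrm{PGL}_n$, $\mathrm{Sp}_{2n}$, $\mathrm{SO}_{2n+1}$, $\mathrm{SO}_{2n}$ and $\mathrm G_2$ admit natural descriptions as matrix groups over the tropical semifield $\mathbb T$ that are analogous to the matrix descriptions of the corresponding algebraic reductive groups.
   Context: A (reduced) root datum is $\Phi=(M,R,\check M,\check R)$ with $M,\check M$ dual free abelian groups of finite rank, and finite sets of roots $R\subseteq M$ and coroots $\check R\subseteq\check M$ in bijection $\alpha\leftrightarrow\check\alpha$, satisfying the usual axioms. The Weyl group $W_\Phi\subseteq\mathrm{Aut}(M)$ is generated by the reflections $s_\alpha$ and acts dually on $\check M$ and on $\check M_{\mathbb R}=\check M\otimes_{\mathbb Z}\mathbb R$. The tropical reductive group associated to $\Phi$ is the semidirect product $\check M_{\mathbb R}\rtimes W_\Phi$. $\mathbb T=(\mathbb R\cup\{\infty\},\oplus=\min,\odot=+)$ is the tropical semifield (additive identity $\infty$, multiplicative identity $0$), with the induced matrix product $\odot$. $I_n$ is the matrix with $0$ on the diagonal and $\infty$ elsewhere. $\mathrm{GL}_n(\mathbb T)$ is the group of $\odot$-invertible $n\times n$ matrices over $\mathbb T$; its elements are exactly the products $D(y)\odot P_\sigma$ of a diagonal matrix $D(y)$ with diagonal $y\in\mathbb R^n$ (and $\infty$ elsewhere) and a tropical permutation matrix $P_\sigma$, $\sigma\in S_n$ ($(P_\sigma)_{ij}=0$ if $i=\sigma(j)$ and $\infty$ otherwise). The tropical determinant is $\det A=\bigoplus_{\sigma\in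 S_n}A_{1\sigma(1)}\odot\cdots\odot A_{n\sigma(n)}$. The descriptions meant in the claim are that the tropical reductive groups associated to the root data of $\mathrm{SL}_n,\mathrm{PGL}_n,\mathrm{Sp}_{2n},\mathrm{SO}_{2n+1},\mathrm{SO}_{2n},\mathrm G_2$ are, respectively, the following matrix groups (coordinates in size $2n$ are indexed by $1,\dots,n,-1,\dots,-n$, in size $2n+1$ by $0,1,\dots,n,-1,\dots,-n$): - $\mathrm{SL}_n(\mathbb T)=\{A\in\mathrm{GL}_n(\mathbb T):\det A=0\}$. - $\mathrm{PGL}_n(\mathbb T)$, the quotient of $\mathrm{GL}_n(\mathbb T)$ by its center, the subgroup of scalar matrices. - $\mathrm{Sp}_{2n}(\mathbb T)=\{A\in \mathrm{GL}_{2n}(\mathbb T):A^t\odot J\odot A=J\}$, where $J=\begin{pmatrix}\infty&I_n\\ I_n&\infty\end{pmatrix}$. - $\mathrm{SO}_{2n+1}(\mathbb T)$, the kernel of the determinant on $\mathrm O_{2n+1}(\mathbb T)$ (which is all of $\mathrm O_{2n+1}(\mathbb T)$), and $\mathrm{SO}_{2n}(\mathbb T)$, the kernel of $\mathrm O_{2n}(\mathbb T)\to\{\pm1\}$, $D(y)\odot P_\sigma\mapsto\mathrm{sgn}(\sigma)$. Here $\mathrm O_m(\mathbb T)=\{A\in\mathrm{GL}_m(\mathbb T):q_m(A\odot x)=q_m(x)\ \forall x\in\mathbb T^m\}$ with $q_{2n}(x)=\bigoplus_{k=1}^n x_k\odot x_{-k}$ and $q_{2n+1}(x)=x_0^{\odot2}\oplus\bigoplus_{k=1}^n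 x_k\odot x_{-k}$. - $G_2(\mathbb T)=\{A\in\mathrm{GL}_7(\mathbb T):c(A\odot x)=c(x)\ \forall x\in\mathbb T^7\}$, where $c(x)=x_1\odot x_3\odot x_5\oplus x_2\odot x_4\odot x_6\oplus x_1\odot x_4\odot x_7\oplus x_2\odot x_5\odot x_7\oplus x_3\odot x_6\odot x_7$. *)

(* Defs.v *)
From HB Require Import structures.
From mathcomp Require Import all_boot all_order all_fingroup all_algebra.
From mathcomp Require Import boolp classical_sets functions reals.
From mathcomp Require Import ring lra zify.

Set Implicit Arguments.
Unset Strict Implicit.
Unset Printing Implicit Defensive.

Import Order.TTheory GRing.Theory Num.Theory.

Local Open Scope ring_scope.

(* T = (R U {oo}, min, +), with None for oo.  It is a commutative semiring in
   the sense of the library, so in ring_scope [+] is the minimum, [*] is the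
   addition of R, [0] is oo and [1] is the real number 0; the library's [*m]
   and [1%:M] are then the tropical matrix product and the matrix I_n. *)
Definition tropical (R : realType) : Type := option R.
Definition trop (R : realType) (x : R) : tropical R := Some x.

Section TropicalSemifield.
Variable R : realType.
Implicit Types a b c : tropical R.

HB.instance Definition _ := Choice.on (tropical R).

Definition trop_add a b : tropical R :=
  match a, b with
  | Some x, Some y => Some (Num.min x y)
  | Some _, None => a
  | None, _ => b
  end.

Definition trop_mul a b : tropical R :=
  match a, b with
  | Some x, Some y => Some (x + y)
  | _, _ => None
  end.

Lemma trop_addA : associative trop_add.
Proof. by move=> [x|] [y|] [z|] //=; rewrite minA. Qed.

Lemma trop_addC : commutative trop_add.
Proof. by move=> [x|] [y|] //=; rewrite minC. Qed.

Lemma trop_add0 : left_id None trop_add.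
Proof. by case. Qed.

Lemma trop_mulA : associative trop_mul.
Proof. by move=> [x|] [y|] [z|] //=; rewrite addrA. Qed.

Lemma trop_mulC : commutative trop_mul.
Proof. by move=> [x|] [y|] //=; rewrite addrC. Qed.

Lemma trop_mul1 : left_id (Some 0) trop_mul.
Proof. by move=> [x|] //=; rewrite add0r. Qed.

Lemma trop_mulDl : left_distributive trop_mul trop_add.
Proof. by move=> [x|] [y|] [z|] //=; rewrite addr_minl. Qed.

Lemma trop_mul0 : left_zero None trop_mul.
Proof. by case. Qed.

HB.instance Definition _ := GRing.isNmodule.Build (tropical R)
  trop_addA trop_addC trop_add0.

HB.instance Definition _ := GRing.Nmodule_isComNzSemiRing.Build (tropical R)
  trop_mulA trop_mulC trop_mul1 trop_mulDl trop_mul0 isT.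

End TropicalSemifield.

(* M = Z^r (columns), M^ = Z^r (rows), paired by <m, y> = y *m m; up to a choice
   of dual bases every pair of dual free abelian groups of finite rank is of
   this form.  The bijection R <-> R^ is given by a finite set indexing both.
   The matrix [1%:M - a *m a^] is the reflection m |-> m - <m, a^> a of M, and
   its right action on rows is the dual reflection y |-> y - <a, y> a^. *)
Definition reflection_mx r (a : 'cV[int]_r) (av : 'rV[int]_r) : 'M[int]_r :=
  1%:M - a *m av.

(* Two roots on the same rational line are equal or opposite. *)
Definition reduced_vectors (I : Type) (V : lmodType int) (root : I -> V) : Prop :=
  forall (i j : I) (a b : int), a != 0 -> a *: root i = b *: root j ->
    root j = root i \/ root j = - root i.

Record root_datum := RootDatum {
  rd_rank : nat;
  rd_index : finType;
  rd_root : rd_index -> 'cV[int]_rd_rank;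
  rd_coroot : rd_index -> 'rV[int]_rd_rank;
  rd_root_inj : injective rd_root;
  rd_coroot_inj : injective rd_coroot;
  rd_pairing2 : forall i, rd_coroot i *m rd_root i = 2%:M;
  rd_root_stable : forall i j, exists k,
    reflection_mx (rd_root i) (rd_coroot i) *m rd_root j = rd_root k;
  rd_coroot_stable : forall i j, exists k,
    rd_coroot j *m reflection_mx (rd_root i) (rd_coroot i) = rd_coroot k;
  rd_reduced : reduced_vectors rd_root
}.

Lemma reflection_mxK r (a : 'cV[int]_r) (av : 'rV[int]_r) :
  av *m a = 2%:M -> reflection_mx a av *m reflection_mx a av = 1%:M.
Proof.
move=> h; have aa : a *m av *m (a *m av) = a *m av + a *m av.
  rewrite mulmxA -(mulmxA a) h mul_mx_scalar -scalemxAl.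
  by rewrite scaler_nat mulr2n.
rewrite /reflection_mx mulmxBl mul1mx mulmxBr mulmx1 aa.
by rewrite opprB addrK subrK.
Qed.

Section WeylGroup.
Variable Phi : root_datum.
Notation r := (rd_rank Phi).

(* The subgroup of Aut(M) = GL_r(Z) generated by the reflections. *)
Inductive in_weyl : 'M[int]_r -> Prop :=
| in_weyl1 : in_weyl 1%:M
| in_weyl_refl (i : rd_index Phi) :
    in_weyl (reflection_mx (rd_root i) (rd_coroot i))
| in_weylM w w' : in_weyl w -> in_weyl w' -> in_weyl (w *m w')
| in_weylV w : in_weyl w -> in_weyl (invmx w).

Definition weyl_group : Type := {w : 'M[int]_r | `[< in_weyl w >]}.
HB.instance Definition _ := Choice.on weyl_group.

Lemma in_weyl_unit w : in_weyl w -> w \in unitmx.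
Proof.
elim=> {w} [|i|w w' _ uw _ uw'|w _ uw]; first exact: unitmx1.
- by have [] := mulmx1_unit (reflection_mxK (rd_pairing2 i)).
- by rewrite unitmx_mul uw.
- by rewrite unitmx_inv.
Qed.

Lemma weyl_unit (w : weyl_group) : val w \in unitmx.
Proof. exact/in_weyl_unit/asboolP/(valP w). Qed.

Definition weyl_one : weyl_group := exist _ 1%:M (asboolT in_weyl1).

Definition weyl_mul (w w' : weyl_group) : weyl_group :=
  exist _ (val w *m val w')
    (asboolT (in_weylM (asboolW (valP w)) (asboolW (valP w')))).

Definition weyl_inv (w : weyl_group) : weyl_group :=
  exist _ (invmx (val w)) (asboolT (in_weylV (asboolW (valP w)))).

Lemma weyl_mulA : associative weyl_mul.
Proof. by move=> u v w; apply: val_inj; rewrite /= mulmxA. Qed.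

Lemma weyl_mul1 : left_id weyl_one weyl_mul.
Proof. by move=> w; apply: val_inj; rewrite /= mul1mx. Qed.

Lemma weyl_mulr1 : right_id weyl_one weyl_mul.
Proof. by move=> w; apply: val_inj; rewrite /= mulmx1. Qed.

Lemma weyl_mulV : left_inverse weyl_one weyl_inv weyl_mul.
Proof. by move=> w; apply: val_inj; rewrite /= mulVmx ?weyl_unit. Qed.

Lemma weyl_mulrV : right_inverse weyl_one weyl_inv weyl_mul.
Proof. by move=> w; apply: val_inj; rewrite /= mulmxV ?weyl_unit. Qed.

HB.instance Definition _ := isGroup.Build weyl_group
  weyl_mulA weyl_mul1 weyl_mulr1 weyl_mulV weyl_mulrV.

End WeylGroup.

Section TropicalReductiveGroup.
Variables (R : realType) (Phi : root_datum).
Notation r := (rd_rank Phi).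

(* M^_R = R^r, with the scalar extension of the dual action of W on M^,
   determined by <w m, w y> = <m, y>. *)
Definition weyl_act (w : weyl_group Phi) (y : 'rV[R]_r) : 'rV[R]_r :=
  y *m map_mx intr (invmx (val w)).

Definition real_pairing (m : 'cV[int]_r) (y : 'rV[R]_r) : R :=
  (y *m map_mx intr m) 0 0.

Record trop_group := TropGroup {
  tg_trans : 'rV[R]_r;
  tg_weyl : weyl_group Phi
}.

Definition trop_group_pair g := (tg_trans g, tg_weyl g).
Definition pair_trop_group (p : 'rV[R]_r * weyl_group Phi) :=
  TropGroup p.1 p.2.
Lemma trop_group_pairK : cancel trop_group_pair pair_trop_group.
Proof. by case. Qed.

HB.instance Definition _ := Choice.copy trop_group (can_type trop_group_pairK).

Definition tg_one := TropGroup 0 1%g.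
Definition tg_mul g h :=
  TropGroup (tg_trans g + weyl_act (tg_weyl g) (tg_trans h))
            (tg_weyl g * tg_weyl h)%g.
Definition tg_inv g :=
  TropGroup (- weyl_act (tg_weyl g)^-1%g (tg_trans g)) (tg_weyl g)^-1%g.

Lemma weyl_actM w w' y : weyl_act (w * w')%g y = weyl_act w (weyl_act w' y).
Proof.
rewrite /weyl_act -mulmxA -map_mxM; congr (y *m map_mx _ _).
have uw := weyl_unit w; have uw' := weyl_unit w'.
apply: (can_inj (mulmxK uw)); rewrite mulmxKV //.
apply: (can_inj (mulmxK uw')); rewrite mulVmx // -mulmxA mulVmx //.
by rewrite unitmx_mul uw.
Qed.

Lemma weyl_act1 y : weyl_act 1%g y = y.
Proof.
rewrite /weyl_act (_ : invmx _ = 1%:M) ?map_mx1 ?mulmx1 //.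
by rewrite -[RHS](mulVmx (unitmx1 _ _)) mulmx1.
Qed.

Lemma weyl_actD w y z : weyl_act w (y + z) = weyl_act w y + weyl_act w z.
Proof. exact: mulmxDl. Qed.

Lemma weyl_actN w y : weyl_act w (- y) = - weyl_act w y.
Proof. exact: mulNmx. Qed.

Lemma weyl_act0 w : weyl_act w 0 = 0.
Proof. exact: mul0mx. Qed.

Lemma tg_mulA : associative tg_mul.
Proof.
by move=> f g h; rewrite /tg_mul /= mulgA weyl_actD weyl_actM addrA.
Qed.

Lemma tg_mul1 : left_id tg_one tg_mul.
Proof. by case=> y w; rewrite /tg_mul /= mul1g weyl_act1 add0r. Qed.

Lemma tg_mulr1 : right_id tg_one tg_mul.
Proof. by case=> y w; rewrite /tg_mul /= mulg1 weyl_act0 addr0. Qed.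

Lemma tg_mulV : left_inverse tg_one tg_inv tg_mul.
Proof. by case=> y w; rewrite /tg_mul /= mulVg addNr. Qed.

Lemma tg_mulrV : right_inverse tg_one tg_inv tg_mul.
Proof.
by case=> y w; rewrite /tg_mul /= mulgV weyl_actN -weyl_actM mulgV weyl_act1 subrr.
Qed.

HB.instance Definition _ := isGroup.Build trop_group
  tg_mulA tg_mul1 tg_mulr1 tg_mulV tg_mulrV.

End TropicalReductiveGroup.

Section CenterQuotient.
Variable G : groupType.
Implicit Types x y z : G.
Local Open Scope group_scope.
Local Open Scope quotient_scope.
Local Notation repr := generic_quotient.repr.

Definition gcenter : set G := [set x | forall y, commute x y].

Definition same_coset x y : bool := `[< gcenter (x^-1 * y) >].

Lemma same_coset_refl : reflexive same_coset.
Proof. by move=> x; apply/asboolP => y; rewrite mulVg; apply/commute_sym/commute1. Qed.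

Lemma gcenterM x y : gcenter x -> gcenter y -> gcenter (x * y).
Proof. by move=> cx cy z; apply/commute_sym/commuteM; apply/commute_sym. Qed.

Lemma gcenterV x : gcenter x -> gcenter x^-1.
Proof. by move=> cx z; apply/commute_sym/commuteV/commute_sym/cx. Qed.

Lemma same_coset_sym : symmetric same_coset.
Proof.
suff h x y : same_coset x y -> same_coset y x by move=> x y; apply/idP/idP; exact: h.
by move=> /asboolP/gcenterV; rewrite invgM invgK => c; apply/asboolP.
Qed.

Lemma same_coset_trans : transitive same_coset.
Proof.
move=> y x z /asboolP cxy /asboolP cyz; apply/asboolP.
by have := gcenterM cxy cyz; rewrite mulgA mulgK.
Qed.

Canonical same_coset_equiv :=
  EquivRel same_coset same_coset_refl same_coset_sym same_coset_trans.

Definition center_quotient : Type := {eq_quot same_coset}.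
HB.instance Definition _ := Choice.on center_quotient.
HB.instance Definition _ := Quotient.on center_quotient.

Definition cq_proj (x : G) : center_quotient := \pi_center_quotient x.

Lemma cq_projP x y : cq_proj x = cq_proj y <-> gcenter (x^-1 * y).
Proof. by rewrite /cq_proj; split=> [/eqquotP/asboolP|h] //; apply/eqquotP/asboolP. Qed.

Definition cq_mul (u v : center_quotient) := cq_proj (repr u * repr v).
Definition cq_inv (u : center_quotient) := cq_proj (repr u)^-1.

Lemma cq_projK u : cq_proj (repr u) = u.
Proof. by rewrite /cq_proj reprK. Qed.

Lemma cq_reprP x : gcenter ((repr (cq_proj x))^-1 * x).
Proof. by apply/cq_projP; rewrite cq_projK. Qed.

Lemma cq_mulE x y : cq_mul (cq_proj x) (cq_proj y) = cq_proj (x * y).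
Proof.
apply/cq_projP; have cx := cq_reprP x; have cy := cq_reprP y.
have := gcenterM cx cy; move: cx cy.
set a := repr _; set b := repr _ => cx cy.
have -> : (a * b)^-1 * (x * y) = a^-1 * x * (b^-1 * y); last by [].
by rewrite invgM -mulgA (mulgA a^-1) mulgA -cx !mulgA.
Qed.

Lemma cq_invE x : cq_inv (cq_proj x) = cq_proj x^-1.
Proof.
apply/cq_projP; have cx := cq_reprP x; move: cx; set a := repr _ => cx.
rewrite invgK; have /gcenterV := cx; rewrite invgM invgK => cV.
have -> : a * x^-1 = x^-1 * a; last by [].
by have := cV x; rewrite /commute (mulgA x) mulgV mul1g => e; rewrite -{1}e mulgK.
Qed.

Lemma cq_mulA : associative cq_mul.
Proof.
move=> u v w; rewrite -(cq_projK u) -(cq_projK v) -(cq_projK w).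
by rewrite !cq_mulE mulgA.
Qed.

Lemma cq_mul1 : left_id (cq_proj 1) cq_mul.
Proof. by move=> u; rewrite -(cq_projK u) cq_mulE mul1g. Qed.

Lemma cq_mulr1 : right_id (cq_proj 1) cq_mul.
Proof. by move=> u; rewrite -(cq_projK u) cq_mulE mulg1. Qed.

Lemma cq_mulV : left_inverse (cq_proj 1) cq_inv cq_mul.
Proof. by move=> u; rewrite -(cq_projK u) cq_invE cq_mulE mulVg. Qed.

Lemma cq_mulrV : right_inverse (cq_proj 1) cq_inv cq_mul.
Proof. by move=> u; rewrite -(cq_projK u) cq_invE cq_mulE mulgV. Qed.

HB.instance Definition _ := isGroup.Build center_quotient
  cq_mulA cq_mul1 cq_mulr1 cq_mulV cq_mulrV.

End CenterQuotient.

Section TropicalGL.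
Variables (R : realType) (n : nat).
Notation T := (tropical R).

Definition tropGL : Type :=
  {A : 'M[T]_n | `[< exists B, A *m B = 1%:M /\ B *m A = 1%:M >]}.
HB.instance Definition _ := Choice.on tropGL.

Definition GL_inverse (A : tropGL) : 'M[T]_n := xget 0 [set B | val A *m B = 1%:M /\ B *m val A = 1%:M].

Lemma GL_inverseP (A : tropGL) :
  val A *m GL_inverse A = 1%:M /\ GL_inverse A *m val A = 1%:M.
Proof.
have /asboolP[B hB] := valP A.
exact: (@xgetPex _ 0 [set B | val A *m B = 1%:M /\ B *m val A = 1%:M] (ex_intro _ B hB)).
Qed.

Definition mkGL (A B : 'M[T]_n) (AB : A *m B = 1%:M) (BA : B *m A = 1%:M) :
  tropGL := exist _ A (asboolT (ex_intro _ B (conj AB BA))).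

Definition GL_one : tropGL := mkGL (mulmx1 1%:M) (mulmx1 1%:M).

Lemma GL_mul_subproof (A B A' B' : 'M[T]_n) :
  A *m A' = 1%:M -> B *m B' = 1%:M -> A *m B *m (B' *m A') = 1%:M.
Proof. by move=> hA hB; rewrite mulmxA -(mulmxA A) hB mulmx1. Qed.

Definition GL_mul (A B : tropGL) : tropGL :=
  mkGL (GL_mul_subproof (GL_inverseP A).1 (GL_inverseP B).1)
       (GL_mul_subproof (GL_inverseP B).2 (GL_inverseP A).2).

Definition GL_inv (A : tropGL) : tropGL :=
  mkGL (GL_inverseP A).2 (GL_inverseP A).1.

Lemma GL_mulA : associative GL_mul.
Proof. by move=> A B C; apply: val_inj; rewrite /= mulmxA. Qed.

Lemma GL_mul1 : left_id GL_one GL_mul.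
Proof. by move=> A; apply: val_inj; rewrite /= mul1mx. Qed.

Lemma GL_mulr1 : right_id GL_one GL_mul.
Proof. by move=> A; apply: val_inj; rewrite /= mulmx1. Qed.

Lemma GL_mulV : left_inverse GL_one GL_inv GL_mul.
Proof. by move=> A; apply: val_inj; rewrite /= (GL_inverseP A).2. Qed.

Lemma GL_mulrV : right_inverse GL_one GL_inv GL_mul.
Proof. by move=> A; apply: val_inj; rewrite /= (GL_inverseP A).1. Qed.

HB.instance Definition _ := isGroup.Build tropGL
  GL_mulA GL_mul1 GL_mulr1 GL_mulV GL_mulrV.

Definition trop_diag_mx (y : 'I_n -> R) : 'M[T]_n :=
  diag_mx (\row_i trop (y i)).

Lemma trop_diag_mxK y :
  trop_diag_mx y *m trop_diag_mx (fun i => - y i) = 1%:M.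
Proof.
rewrite /trop_diag_mx mulmx_diag -diag_const_mx; congr diag_mx.
by apply/rowP => i; rewrite !mxE; congr Some; rewrite subrr.
Qed.

Lemma trop_diag_mxVK y :
  trop_diag_mx (fun i => - y i) *m trop_diag_mx y = 1%:M.
Proof.
rewrite /trop_diag_mx mulmx_diag -diag_const_mx; congr diag_mx.
by apply/rowP => i; rewrite !mxE; congr Some; rewrite addNr.
Qed.

Definition trop_perm_mx (s : 'S_n) : 'M[T]_n :=
  \matrix_(i, j) (i == s j)%:R.

Lemma trop_perm_mxM s t :
  trop_perm_mx s *m trop_perm_mx t = trop_perm_mx (t * s).
Proof.
apply/matrixP => i j; rewrite !mxE (bigD1 (t j)) //= big1 => [|k kt].
  by rewrite !mxE eqxx mulr1 addr0 permM.
by rewrite !mxE (negPf kt) mulr0.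
Qed.

Lemma trop_perm_mx1 : trop_perm_mx 1 = 1%:M.
Proof. by apply/matrixP => i j; rewrite !mxE perm1. Qed.

Lemma trop_perm_mxK s : trop_perm_mx s *m trop_perm_mx s^-1 = 1%:M.
Proof. by rewrite trop_perm_mxM mulVg trop_perm_mx1. Qed.

Lemma trop_perm_mxVK s : trop_perm_mx s^-1 *m trop_perm_mx s = 1%:M.
Proof. by rewrite trop_perm_mxM mulgV trop_perm_mx1. Qed.

Definition GLdiag (y : 'I_n -> R) : tropGL :=
  mkGL (trop_diag_mxK y) (trop_diag_mxVK y).
Definition GLperm (s : 'S_n) : tropGL :=
  mkGL (trop_perm_mxK s) (trop_perm_mxVK s).

Definition trop_det (A : 'M[T]_n) : T := \sum_(s : 'S_n) \prod_i A i (s i).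

Definition tropSL : set tropGL := [set A | trop_det (val A) = trop 0].

Definition GLscalar : set tropGL := [set A | exists a, A = GLdiag (fun=> a)].

Definition tropPGL : groupType := center_quotient tropGL.

Definition stabilizer (q : 'cV[T]_n -> T) : set tropGL :=
  [set A | forall x, q (val A *m x) = q x].

End TropicalGL.

Section ClassicalMatrixGroups.
Variables (R : realType) (n : nat).
Notation T := (tropical R).

(* [lshift n k] and [rshift n k] stand for the indices k and -k, and in size
   1 + (n + n) the first index stands for 0. *)
Definition trop_J : 'M[T]_(n + n) := block_mx 0 1%:M 1%:M 0.

Definition tropSp : set (tropGL R (n + n)) :=
  [set A | (val A)^T *m trop_J *m val A = trop_J].

Definition q_even (x : 'cV[T]_(n + n)) : T :=
  \sum_(k < n) x (lshift n k) 0 * x (rshift n k) 0.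

Definition q_odd (x : 'cV[T]_(1 + (n + n))) : T :=
  x (lshift (n + n) 0) 0 ^+ 2 + q_even (dsubmx x).

Definition tropO_even : set (tropGL R (n + n)) := stabilizer q_even.
Definition tropO_odd : set (tropGL R (1 + (n + n))) := stabilizer q_odd.

Definition tropSO_odd : set (tropGL R (1 + (n + n))) :=
  [set A | tropO_odd A /\ trop_det (val A) = trop 0].

(* The sign of A = D(y) P_s is that of s; y and s are determined by A. *)
Definition tropSO_even : set (tropGL R (n + n)) :=
  [set A | tropO_even A /\
    exists y s, A = (GLdiag y * GLperm R s)%g /\ ~~ odd_perm s].

End ClassicalMatrixGroups.

Section TropicalG2.
Variable R : realType.
Notation T := (tropical R).

(* Coordinates are numbered from 1 to 7. *)
Definition coord7 (x : 'cV[T]_7) (k : nat) : T := x (inord k.-1) 0.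

Definition g2_cubic (x : 'cV[T]_7) : T :=
  let x_ := coord7 x in
  x_ 1%N * x_ 3%N * x_ 5%N + x_ 2%N * x_ 4%N * x_ 6%N + x_ 1%N * x_ 4%N * x_ 7%N
  + x_ 2%N * x_ 5%N * x_ 7%N + x_ 3%N * x_ 6%N * x_ 7%N.

Definition tropG2 : set (tropGL R 7) := stabilizer g2_cubic.

End TropicalG2.

Lemma mx_eq_or_opp m n (u v : 'M[int]_(m, n)) (a b c d : int) :
  a != 0 -> a *: u = b *: v -> a * 2 = b * c -> a * d = b * 2 ->
  `|c| <= 3 -> `|d| <= 3 -> v = u \/ v = - u.
Proof.
move=> a0 e hc hd; have cd : c * d = 4.
  apply: (mulfI a0); rewrite (mulrC c) mulrA hd -mulrA (mulrC 2) mulrA -hc.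
  by rewrite -mulrA.
rewrite !ler_norml => c3 d3; have [ab|ab] : a = b \/ a = - b.
  have : c = 1 \/ c = 2 \/ c = 3 \/ c = 0 \/ c = -1 \/ c = -2 \/ c = -3 by lia.
  by move=> h; (repeat case: h => [|h]); try move: h; move=> h; subst c; lia.
- by left; apply/matrixP => i j; apply: (mulfI a0); have /matrixP/(_ i j) := e;
    rewrite !mxE -ab.
right; apply/matrixP => i j; apply: (mulfI a0); have /matrixP/(_ i j) := e.
by rewrite !mxE mulrN => ->; rewrite ab mulNr.
Qed.

Section Reduced.
Variables (I : finType) (r : nat) (root : I -> 'cV[int]_r) (coroot : I -> 'rV[int]_r).
Hypothesis pairing2 : forall i, coroot i *m root i = 2%:M.
Hypothesis pairing_le3 : forall i j, `|(coroot i *m root j) 0 0| <= 3.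

Lemma pairing2_00 i : (coroot i *m root i) 0 0 = 2.
Proof. by rewrite pairing2 mxE. Qed.

Lemma reduced_root : reduced_vectors root.
Proof.
move=> i j a b a0 e; apply: (mx_eq_or_opp a0 e _ _ (pairing_le3 i j) (pairing_le3 j i)).
- by have /(congr1 (fun v => (coroot i *m v) 0 0)) := e;
    rewrite -!scalemxAr [LHS]mxE [RHS]mxE !pairing2_00.
- by have /(congr1 (fun v => (coroot j *m v) 0 0)) := e;
    rewrite -!scalemxAr [LHS]mxE [RHS]mxE !pairing2_00.
Qed.

Lemma reduced_coroot : reduced_vectors coroot.
Proof.
move=> i j a b a0 e; apply: (mx_eq_or_opp a0 e _ _ (pairing_le3 j i) (pairing_le3 i j)).
- by have /(congr1 (fun v => (v *m root i) 0 0)) := e;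
    rewrite -!scalemxAl [LHS]mxE [RHS]mxE !pairing2_00.
- by have /(congr1 (fun v => (v *m root j) 0 0)) := e;
    rewrite -!scalemxAl [LHS]mxE [RHS]mxE !pairing2_00.
Qed.
End Reduced.

(* The dual root datum (M^, R^, M, R). *)
Section Dual.
Variable Phi : root_datum.
Hypothesis reduced : reduced_vectors (@rd_coroot Phi).

Lemma dual_root_inj : injective (fun i : rd_index Phi => (rd_coroot i)^T).
Proof. by move=> i j /trmx_inj/rd_coroot_inj. Qed.

Lemma dual_coroot_inj : injective (fun i : rd_index Phi => (rd_root i)^T).
Proof. by move=> i j /trmx_inj/rd_root_inj. Qed.

Lemma dual_pairing2 (i : rd_index Phi) : (rd_root i)^T *m (rd_coroot i)^T = 2%:M.
Proof. by rewrite -trmx_mul rd_pairing2 tr_scalar_mx. Qed.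

Lemma dual_reflection (i : rd_index Phi) :
  reflection_mx (rd_coroot i)^T (rd_root i)^T =
  (reflection_mx (rd_root i) (rd_coroot i))^T.
Proof. by rewrite /reflection_mx linearB /= trmx1 trmx_mul. Qed.

Lemma dual_root_stable (i j : rd_index Phi) : exists k,
  reflection_mx (rd_coroot i)^T (rd_root i)^T *m (rd_coroot j)^T = (rd_coroot (r := Phi) k)^T.
Proof.
by have [k hk] := rd_coroot_stable i j; exists k; rewrite dual_reflection -trmx_mul hk.
Qed.

Lemma dual_coroot_stable (i j : rd_index Phi) : exists k,
  (rd_root j)^T *m reflection_mx (rd_coroot i)^T (rd_root i)^T = (rd_root (r := Phi) k)^T.
Proof.
by have [k hk] := rd_root_stable i j; exists k; rewrite dual_reflection -trmx_mul hk.
Qed.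

Lemma dual_reduced : reduced_vectors (fun i : rd_index Phi => (rd_coroot i)^T).
Proof.
move=> i j a b a0 /(congr1 trmx); rewrite !linearZ /= !trmxK => /(reduced a0).
by case=> ->; [left | right; rewrite linearN].
Qed.

Definition dual_datum : root_datum := RootDatum dual_root_inj dual_coroot_inj
  dual_pairing2 dual_root_stable dual_coroot_stable dual_reduced.
End Dual.

Section SLDatum.
Variable n : nat.

(* M = Z^n / Z(1,...,1) and M^ = {y in Z^n | y_1 + ... + y_n = 0}, of rank n - 1;
   y in M^ is given by its first n - 1 coordinates, and M by the dual basis.
   [sl_weight i] is the class of e_i in M, i.e. the i-th coordinate function on
   M^, and [sl_coweight i] is the truncation of e_i, so that
   [sl_coweight i - sl_coweight j] is the element e_i - e_j of M^. *)
Definition sl_weight (i : 'I_n) : 'cV[int]_n.-1 :=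
  \col_k ((k == i :> nat)%:R - (i == n.-1 :> nat)%:R).
Definition sl_coweight (i : 'I_n) : 'rV[int]_n.-1 := \row_k (k == i :> nat)%:R.

Definition sl_index : finType := {p : 'I_n * 'I_n | p.1 != p.2}.
Definition sl_root (p : sl_index) := sl_weight (val p).1 - sl_weight (val p).2.
Definition sl_coroot (p : sl_index) := sl_coweight (val p).1 - sl_coweight (val p).2.

Lemma sl_pairing k i :
  sl_coweight k *m sl_weight i = ((k == i)%:R - (i == n.-1 :> nat)%:R)%:M.
Proof.
apply/matrixP => a b; rewrite !ord1 !mxE eqxx mulr1n.
case: (ltnP k n.-1) => hk.
  rewrite (bigD1 (Ordinal hk)) //= big1 => [|l hl].
    by rewrite !mxE eqxx mul1r addr0.
  by rewrite !mxE (_ : (_ == _ :> nat) = false) ?mul0r //; apply/negbTE.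
have kE : k = n.-1 :> nat by have := ltn_ord k; lia.
rewrite big1 => [|l _]; last first.
  by rewrite !mxE (_ : (_ == _ :> nat) = false) ?mul0r //; have := ltn_ord l; lia.
by rewrite -val_eqE /= kE eq_sym subrr.
Qed.

Lemma sl_pairing_diff u v i j :
  (sl_coweight u - sl_coweight v) *m (sl_weight i - sl_weight j) =
  ((u == i)%:R - (u == j)%:R - ((v == i)%:R - (v == j)%:R))%:M.
Proof.
rewrite mulmxBl !mulmxBr !sl_pairing -!raddfB /=; congr (_%:M).
by ring.
Qed.

Lemma sl_pairing2 p : sl_coroot p *m sl_root p = 2%:M.
Proof.
by rewrite sl_pairing_diff !eqxx (eq_sym (val p).2) (negPf (valP p)).
Qed.

Lemma sl_pairing_le2 p q : `|(sl_coroot p *m sl_root q) 0 0| <= 3.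
Proof. by rewrite sl_pairing_diff mxE; do 4!case: (_ == _). Qed.

Lemma sl_pairing_inj (p q : sl_index) : (sl_coroot p *m sl_root q) 0 0 = 2 -> p = q.
Proof.
rewrite sl_pairing_diff mxE => h; apply: val_inj.
case: p q h => [[a b] /= ab] [[c d] /= cd].
by case: (a =P c) => [->|] //; case: (b =P d) => [->|] //; do 2!case: (_ == _).
Qed.

Lemma sl_root_inj : injective sl_root.
Proof. by move=> p q e; apply: sl_pairing_inj; rewrite -e sl_pairing2 mxE. Qed.

Lemma sl_coroot_inj : injective sl_coroot.
Proof. by move=> p q e; apply: sl_pairing_inj; rewrite e sl_pairing2 mxE. Qed.

Lemma tperm_diff (V : lmodType int) (f : 'I_n -> V) i j u :
  f u - ((u == i)%:R - (u == j)%:R) *: (f i - f j) = f (tperm i j u).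
Proof.
case: tpermP => [->|->|/eqP ui /eqP uj].
- rewrite eqxx; case: eqP => [<-|_]; first by rewrite !subrr scale0r subr0.
  by rewrite subr0 scale1r opprB addrCA subrr addr0.
- rewrite eqxx; case: eqP => [->|_]; first by rewrite !subrr scale0r subr0.
  by rewrite sub0r scaleN1r opprK addrCA subrr addr0.
by rewrite (negPf ui) (negPf uj) subr0 scale0r subr0.
Qed.

Lemma scaler_diff (V : lmodType int) (x y z : V) (a b : int) :
  x - y - (a - b) *: z = x - a *: z - (y - b *: z).
Proof.
by rewrite scalerBl !opprB addrACA [RHS]addrACA [- y - _]addrC.
Qed.

Lemma sl_index_tperm i j (p : sl_index) :
  exists q : sl_index, val q = (tperm i j (val p).1, tperm i j (val p).2).
Proof.
have h : tperm i j (val p).1 != tperm i j (val p).2.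
  by rewrite inj_eq ?(valP p) //; apply: perm_inj.
by exists (exist (fun q : 'I_n * 'I_n => is_true (q.1 != q.2)) (_, _) h).
Qed.

Lemma sl_root_stable p q : exists k,
  reflection_mx (sl_root p) (sl_coroot p) *m sl_root q = sl_root k.
Proof.
have [k hk] := sl_index_tperm (val p).1 (val p).2 q; exists k.
rewrite /reflection_mx mulmxBl mul1mx -mulmxA sl_pairing_diff mul_mx_scalar.
rewrite /sl_root hk /= -!tperm_diff.
rewrite 2!(eq_sym (val p).1) 2!(eq_sym (val p).2) -scaler_diff.
by congr (_ - _ *: _); ring.
Qed.

Lemma sl_coroot_stable p q : exists k,
  sl_coroot q *m reflection_mx (sl_root p) (sl_coroot p) = sl_coroot k.
Proof.
have [k hk] := sl_index_tperm (val p).1 (val p).2 q; exists k.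
rewrite /reflection_mx mulmxBr mulmx1 mulmxA sl_pairing_diff mul_scalar_mx.
by rewrite /sl_coroot hk /= -!tperm_diff -scaler_diff.
Qed.

Definition SL_datum : root_datum := RootDatum sl_root_inj sl_coroot_inj
  sl_pairing2 sl_root_stable sl_coroot_stable (reduced_root sl_pairing2 sl_pairing_le2).

(* M = {m in Z^n | m_1 + ... + m_n = 0} and M^ = Z^n / Z(1,...,1). *)
Definition PGL_datum : root_datum :=
  @dual_datum SL_datum (reduced_coroot sl_pairing2 sl_pairing_le2).

End SLDatum.

Section SignedDatum.
Variables (long : bool) (n : nat).

(* (k, false) and (k, true) stand for the indices k and -k. *)
Notation sidx := ('I_n * bool)%type.

Definition signed_weight (s : sidx) : 'cV[int]_n := (-1) ^+ s.2 *: delta_mx s.1 0.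

(* Each root of the form +-e_k +-e_l with k < l, and each +-2e_k when [long]
   holds, occurs exactly once as e_s + e_t; the coroot of +-2e_k is +-e_k. *)
Definition signed_index : finType :=
  {p : sidx * sidx | (p.1.1 < p.2.1)%N || long && (p.1 == p.2)}.
Definition signed_root (p : signed_index) : 'cV[int]_n :=
  signed_weight (val p).1 + signed_weight (val p).2.
Definition signed_coroot (p : signed_index) : 'rV[int]_n :=
  if (val p).1 == (val p).2 then (signed_weight (val p).1)^T else (signed_root p)^T.

Definition sneg (s : sidx) : sidx := (s.1, ~~ s.2).

Definition sdot (s t : sidx) : int :=
  if s == t then 1 else if s == sneg t then -1 else 0.

Lemma signed_weightN s : signed_weight (sneg s) = - signed_weight s.
Proof. by case: s => k []; rewrite /signed_weight /= ?scaleN1r ?scale1r ?opprK. Qed.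

Lemma signed_pairing s t : (signed_weight s)^T *m signed_weight t = (sdot s t)%:M.
Proof.
rewrite /signed_weight [(_ *: _)^T]linearZ /= trmx_delta -scalemxAl -scalemxAr scalerA.
rewrite mul_delta_mx_cond -scalemx1 /sdot /sneg.
case: s t => k b [l c] /=; rewrite !xpair_eqE /=; case: eqP => _ /=; last first.
  by rewrite mulr0n scaler0 scale0r.
rewrite mulr1n (_ : delta_mx 0 0 = 1%:M); last first.
  by apply/matrixP => i j; rewrite !ord1 !mxE.
by case: b c => [] [].
Qed.

Lemma sdotC s t : sdot s t = sdot t s.
Proof.
rewrite /sdot eq_sym; case: eqP => // _; case: s t => k b [l c].
by rewrite !xpair_eqE /= eq_sym; case: b c => [] [].
Qed.

(* The reflection in e_s + e_t maps e_u to e_(srefl s t u). *)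
Definition srefl (s t u : sidx) : sidx :=
  if u == s then sneg t else if u == sneg s then t
  else if u == t then sneg s else if u == sneg t then s else u.

Lemma srefl1 s t u : (srefl s t u).1 = tperm s.1 t.1 u.1.
Proof.
case: s t u => [s a] [t b] [u c]; rewrite /srefl /sneg !xpair_eqE /=.
case: tpermP => [->|->|/eqP us /eqP ut].
- by rewrite eqxx; case: a c => [] [].
- case: eqP => [->|_]; first by case: a c => [] [].
  by rewrite eqxx; case: b c => [] [].
by rewrite (negPf us) (negPf ut).
Qed.

Lemma srefl_valid s t u v : (u.1 != v.1) || long && (u == v) ->
  ((srefl s t u).1 != (srefl s t v).1) || long && (srefl s t u == srefl s t v).
Proof.
case/orP => [uv|/andP[-> /eqP->]]; last by apply/orP; right; rewrite eqxx.
by rewrite !srefl1 inj_eq ?uv //; apply: perm_inj.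
Qed.

Lemma signed_index_ex u v : (u.1 != v.1) || long && (u == v) ->
  exists k : signed_index,
    signed_root k = signed_weight u + signed_weight v /\
    signed_coroot k = if u == v then (signed_weight u)^T
                      else (signed_weight u + signed_weight v)^T.
Proof.
pose signed_pair (p : sidx * sidx) :=
  is_true ((p.1.1 < p.2.1)%N || long && (p.1 == p.2)).
move=> h; have [uv|vu|e] := ltngtP u.1 v.1.
- have hk : (u.1 < v.1)%N || long && (u == v) by rewrite uv.
  by exists (exist signed_pair (u, v) hk).
- have hk : (v.1 < u.1)%N || long && (v == u) by rewrite vu.
  exists (exist signed_pair (v, u) hk); rewrite /signed_coroot /signed_root /= addrC (eq_sym v).
  by split=> //; case: eqP => [->|].
have hk : (u.1 < v.1)%N || long && (u == v).
  by move/val_inj: e h => ->; rewrite eqxx /= ltnn.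
by exists (exist signed_pair (u, v) hk).
Qed.

Lemma signed_index_valid (p : signed_index) :
  ((val p).1.1 != (val p).2.1) || long && ((val p).1 == (val p).2).
Proof.
by case/orP: (valP p) => h; apply/orP; [left; rewrite neq_ltn h | right].
Qed.

Lemma sdot_bound s t : `|sdot s t| <= 1.
Proof. by rewrite /sdot; case: ifP => // _; case: ifP. Qed.

Lemma sdotxx s : sdot s s = 1.
Proof. by rewrite /sdot eqxx. Qed.

Lemma sdot0 s t : s.1 != t.1 -> sdot s t = 0.
Proof. by rewrite /sdot /sneg; case: s t => k b [l c] /= /negPf h; rewrite !xpair_eqE h. Qed.

Lemma sdot_bound2 s u v : u.1 != v.1 -> `|sdot s u + sdot s v| <= 1.
Proof.
move=> uv; case: (s.1 =P u.1) => [e|/eqP h].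
  by rewrite (sdot0 (t := v)) ?addr0 ?sdot_bound // e.
by rewrite (sdot0 h) add0r sdot_bound.
Qed.

Lemma signed_pairingE p q : (signed_coroot p *m signed_root q) 0 0 =
  let: (s, t) := val p in let: (u, v) := val q in
  if s == t then sdot s u + sdot s v
  else sdot s u + sdot s v + (sdot t u + sdot t v).
Proof.
rewrite /signed_coroot /signed_root; case: p q => [[s t] /= _] [[u v] /= _].
case: ifP => _; first by rewrite mulmxDr !signed_pairing !mxE.
by rewrite [(_ + _)^T]linearD /= mulmxDl !mulmxDr !signed_pairing !mxE.
Qed.

Lemma signed_pairing2 p : signed_coroot p *m signed_root p = 2%:M.
Proof.
apply/matrixP => a b; rewrite !ord1 signed_pairingE mxE.
have := signed_index_valid p; case: (val p) => s t /= st.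
case: eqP => [<-|/eqP h]; first by rewrite sdotxx.
by move: st; rewrite (negPf h) andbF orbF => st; rewrite !sdotxx (sdotC t) !(sdot0 st).
Qed.

Lemma signed_pairing_le3 p q : `|(signed_coroot p *m signed_root q) 0 0| <= 3.
Proof.
rewrite signed_pairingE; have := signed_index_valid p; have := signed_index_valid q.
case: (val p) (val q) => s t [u v] /= uv st.
case: eqP => [_|/eqP h].
  by have := sdot_bound s u; have := sdot_bound s v; lia.
move: st; rewrite (negPf h) andbF orbF => st.
have := sdot_bound2 u st; have := sdot_bound2 v st.
by rewrite !(sdotC u) !(sdotC v); lia.
Qed.

Lemma signed_pairing_inj p q : (signed_coroot p *m signed_root q) 0 0 = 2 ->
  (signed_coroot q *m signed_root p) 0 0 = 2 -> p = q.
Proof.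
rewrite !signed_pairingE => h1 h2; apply: val_inj; move: h1 h2.
have := valP p; have := valP q; case: (val p) (val q) => s t [u v] /= uv st.
have sdot1 x y : sdot x y = 1 -> x = y.
  by rewrite /sdot; case: eqP => // _; case: ifP.
have two x y z : y.1 != z.1 -> sdot x y + sdot x z = 2 -> False.
  by move=> yz; have := sdot_bound2 x yz; lia.
have [e|st'] := eqVneq s t; have [e'|uv'] := eqVneq u v.
- by subst t v => h _; rewrite (sdot1 s u) //; lia.
- by move=> h; case: (two s u v) => //; move: uv; rewrite (negPf uv') andbF orbF neq_ltn => ->.
- by move=> _ h; case: (two u s t) => //; move: st; rewrite (negPf st') andbF orbF neq_ltn => ->.
move: uv st; rewrite (negPf uv') (negPf st') !andbF !orbF => uv st + _.
have uvn : u.1 != v.1 by rewrite neq_ltn uv.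
have stn : s.1 != t.1 by rewrite neq_ltn st.
have := sdot_bound2 s uvn; have := sdot_bound2 t uvn => b1 b2 h.
have {b1 b2 h} [hs ht] : sdot s u + sdot s v = 1 /\ sdot t u + sdot t v = 1 by lia.
have su : s.1 = u.1 \/ s.1 = v.1.
  case: (s.1 =P u.1) => [|/eqP a]; first by left.
  by case: (s.1 =P v.1) => [|/eqP b]; [right | move: hs; rewrite !sdot0].
have tu : t.1 = u.1 \/ t.1 = v.1.
  case: (t.1 =P u.1) => [|/eqP a]; first by left.
  by case: (t.1 =P v.1) => [|/eqP b]; [right | move: ht; rewrite !sdot0].
have [e1 e2] : s.1 = u.1 /\ t.1 = v.1.
  case: su => e1; case: tu => e2 //.
  - by move: stn; rewrite e1 e2 eqxx.
  - by move: st; rewrite e1 e2 ltnNge ltnW.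
  - by move: stn; rewrite e1 e2 eqxx.
have -> : s = u by apply: sdot1; move: hs; rewrite (sdot0 (t := v)) ?addr0 // e1.
have -> // : t = v.
by apply: sdot1; move: ht; rewrite (sdot0 (t := u)) ?add0r // e2 eq_sym.
Qed.

Lemma signed_root_inj : injective signed_root.
Proof.
move=> p q e; apply: signed_pairing_inj.
  by rewrite -e signed_pairing2 mxE.
by rewrite e signed_pairing2 mxE.
Qed.

Lemma signed_coroot_inj : injective signed_coroot.
Proof.
move=> p q e; apply: signed_pairing_inj.
  by rewrite e signed_pairing2 mxE.
by rewrite -e signed_pairing2 mxE.
Qed.

Lemma signed_reflection_weight p u :
  reflection_mx (signed_root p) (signed_coroot p) *m signed_weight u =
  signed_weight (srefl (val p).1 (val p).2 u).
Proof.
rewrite /reflection_mx mulmxBl mul1mx -mulmxA.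
have := signed_index_valid p; rewrite /signed_coroot /signed_root.
case: p => [[s t] /= _]; case: (s =P t) => [e _|/eqP st]; first subst t.
  rewrite signed_pairing mul_mx_scalar /sdot /srefl ![s == _]eq_sym.
  have -> : (sneg u == s) = (u == sneg s).
    by case: s u => k b [l c]; rewrite !xpair_eqE /=; case: b c => [] [].
  case: eqP => [->|_].
    by rewrite signed_weightN scale1r opprD addrA subrr add0r.
  case: eqP => [->|_]; last by rewrite scale0r subr0.
  by rewrite signed_weightN scaleN1r opprK addrA addNr add0r.
rewrite andbF orbF => st1.
have -> : (signed_weight s + signed_weight t)^T *m signed_weight u =
    (sdot s u + sdot t u)%:M.
  by rewrite [(_ + _)^T]linearD /= mulmxDl !signed_pairing raddfD.
rewrite mul_mx_scalar.
have snegE x y : (x == sneg y) = (y == sneg x).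
  by case: x y => k b [l c]; rewrite !xpair_eqE /= eq_sym; case: b c => [] [].
rewrite /sdot /srefl !(eq_sym _ u) !(snegE _ u).
have tns : (t == s) = false by rewrite eq_sym (negPf st).
have sns x : (x == sneg x) = false by case: x => k b; rewrite xpair_eqE /= eqxx; case: b.
have nsn x : (sneg x == x) = false by rewrite eq_sym sns.
have stn : (s == sneg t) = false.
  by apply/negP => /eqP h; move: st1; rewrite h eqxx.
have tsn : (t == sneg s) = false by rewrite snegE.
have nsnt : (sneg s == sneg t) = false.
  apply/negP => /eqP [h _]; by move: st1; rewrite h eqxx.
have nst : (sneg s == t) = false by rewrite eq_sym.
have nts : (sneg t == s) = false by rewrite eq_sym.
case: (u =P s) => [->|_].
  rewrite (negPf st) stn addr0 scale1r signed_weightN.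
  by rewrite opprD addrA subrr add0r.
case: (u =P sneg s) => [->|_].
  rewrite nst nsnt addr0 scaleN1r opprK signed_weightN.
  by rewrite addrA addNr add0r.
case: (u =P t) => [->|_].
  by rewrite add0r scale1r signed_weightN opprD addrCA subrr addr0.
case: (u =P sneg t) => [->|_]; last by rewrite addr0 scale0r subr0.
by rewrite add0r scaleN1r opprK signed_weightN addrCA addNr addr0.
Qed.

Lemma signed_reflection_coweight p u :
  (signed_weight u)^T *m reflection_mx (signed_root p) (signed_coroot p) =
  (signed_weight (srefl (val p).1 (val p).2 u))^T.
Proof.
rewrite -signed_reflection_weight trmx_mul; congr (_ *m _).
rewrite /reflection_mx linearB /= trmx1 trmx_mul; congr (_ - _).
rewrite /signed_coroot /signed_root; case: eqP => [->|_]; rewrite trmxK //.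
by rewrite [(_ + _)^T]linearD /= mulmxDl mulmxDr.
Qed.

Lemma signed_root_stable p q : exists k,
  reflection_mx (signed_root p) (signed_coroot p) *m signed_root q = signed_root k.
Proof.
have [k [hk _]] :=
  signed_index_ex (srefl_valid (val p).1 (val p).2 (signed_index_valid q)).
by exists k; rewrite hk mulmxDr !signed_reflection_weight.
Qed.

Lemma signed_coroot_stable p q : exists k,
  signed_coroot q *m reflection_mx (signed_root p) (signed_coroot p) = signed_coroot k.
Proof.
have [k [_ hk]] :=
  signed_index_ex (srefl_valid (val p).1 (val p).2 (signed_index_valid q)).
exists k; rewrite hk {1}/signed_coroot {1}/signed_root.
case: eqP => [->|/eqP h]; first by rewrite eqxx signed_reflection_coweight.
have := signed_index_valid q; rewrite (negPf h) andbF orbF => h1.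
rewrite ifF; last first.
  apply/negP => /eqP /(congr1 fst); rewrite !srefl1 => /perm_inj e.
  by rewrite e eqxx in h1.
by rewrite ![(_ + _)^T]linearD /= mulmxDl !signed_reflection_coweight.
Qed.

Definition signed_datum : root_datum := RootDatum signed_root_inj signed_coroot_inj
  signed_pairing2 signed_root_stable signed_coroot_stable
  (reduced_root signed_pairing2 signed_pairing_le3).

End SignedDatum.

(* R = {+-e_k +-e_l} U {+-2e_k}, with coroots +-e_k +-e_l and +-e_k. *)
Definition Sp_datum (n : nat) : root_datum := signed_datum true n.

(* R = {+-e_k +-e_l} U {+-e_k}, with coroots +-e_k +-e_l and +-2e_k. *)
Definition SO_odd_datum (n : nat) : root_datum :=
  @dual_datum (signed_datum true n)
    (reduced_coroot (@signed_pairing2 true n) (@signed_pairing_le3 true n)).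

(* R = {+-e_k +-e_l}, with coroots +-e_k +-e_l. *)
Definition SO_even_datum (n : nat) : root_datum := signed_datum false n.

Section G2Datum.

(* M is the root lattice, with basis the short simple root a and the long simple
   root b, and M^ has the dual basis.  The list gives the positive roots
   a, b, a + b, 2a + b, 3a + b, 3a + 2b with their coroots
   a^ = (2, -3), b^ = (-1, 2), a^ + 3b^, 2a^ + 3b^, a^ + b^, a^ + 2b^. *)
Definition g2_positive : seq ((int * int) * (int * int)) :=
  [:: ((1, 0), (2, -3)); ((0, 1), (-1, 2)); ((1, 1), (-1, 3));
      ((2, 1), (1, 0)); ((3, 1), (1, -1)); ((3, 2), (0, 1))].

Definition g2_vec (p : int * int) : 'rV[int]_2 :=
  \row_k (if k == 0 then p.1 else p.2).

Definition g2_index : finType := ('I_6 * bool)%type.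
Definition g2_pair (i : nat) : (int * int) * (int * int) :=
  nth ((0, 0), (0, 0)) g2_positive i.
Definition g2_root (x : g2_index) : 'cV[int]_2 :=
  (-1) ^+ x.2 *: (g2_vec (g2_pair x.1).1)^T.
Definition g2_coroot (x : g2_index) : 'rV[int]_2 :=
  (-1) ^+ x.2 *: g2_vec (g2_pair x.1).2.

Let sgnp (b : bool) (p : int * int) : int * int := if b then (- p.1, - p.2) else p.
Let rp (i : nat) (b : bool) := sgnp b (g2_pair i).1.
Let cp (i : nat) (b : bool) := sgnp b (g2_pair i).2.
Let dotp (p q : int * int) : int := p.1 * q.1 + p.2 * q.2.
Let subp (p q : int * int) (c : int) : int * int := (p.1 - c * q.1, p.2 - c * q.2).

Lemma g2_vec_sgn (b : bool) p : (-1) ^+ b *: g2_vec p = g2_vec (sgnp b p).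
Proof.
apply/rowP => k; case: b; rewrite !mxE ?mul1r //.
by case: ifP => _; rewrite expr1 mulN1r.
Qed.

Lemma g2_rootE x : g2_root x = (g2_vec (rp x.1 x.2))^T.
Proof. by rewrite /rp -g2_vec_sgn linearZ. Qed.

Lemma g2_corootE x : g2_coroot x = g2_vec (cp x.1 x.2).
Proof. by rewrite /cp -g2_vec_sgn. Qed.

Lemma g2_dot p q : g2_vec p *m (g2_vec q)^T = (dotp p q)%:M.
Proof.
by apply/matrixP => i j; rewrite !ord1 !mxE !big_ord_recl big_ord0 !mxE /= addr0.
Qed.

Lemma g2_sub p q c : g2_vec p - c *: g2_vec q = g2_vec (subp p q c).
Proof. by apply/rowP => k; rewrite !mxE; case: ifP. Qed.

Lemma g2_vec_inj : injective g2_vec.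
Proof.
move=> [a b] [c d] /rowP e; have := e 0; have := e 1.
by rewrite !mxE /= => -> ->.
Qed.

Let forall2 (P : nat -> bool -> nat -> bool -> bool) :=
  all (fun i => all (fun b => all (fun j => all (P i b j) [:: true; false])
    (iota 0 6)) [:: true; false]) (iota 0 6).

Lemma g2_forall2 P : forall2 P -> forall x y : g2_index, P x.1 x.2 y.1 y.2.
Proof.
move=> h [i b] [j c] /=.
have mem k : nat_of_ord (k : 'I_6) \in iota 0 6 by rewrite mem_iota ltn_ord.
have memb b' : b' \in [:: true; false] by case: b'.
by have /allP/(_ _ (mem i))/allP/(_ _ (memb b))/allP/(_ _ (mem j))/allP/(_ _ (memb c)) := h.
Qed.

Let has1 (P : nat -> bool -> bool) :=
  has (fun i => has (P i) [:: true; false]) (iota 0 6).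

Lemma g2_has P : has1 P -> exists x : g2_index, P x.1 x.2.
Proof.
move=> /hasP[i]; rewrite mem_iota => hi /hasP[b _ h].
by exists (Ordinal (hi : (i < 6)%N), b).
Qed.

Lemma g2_pairing2 x : g2_coroot x *m g2_root x = 2%:M.
Proof.
rewrite g2_rootE g2_corootE g2_dot; congr (_%:M).
have /g2_forall2/(_ x x)/eqP : forall2 (fun i b _ _ => dotp (cp i b) (rp i b) == 2).
  by vm_compute.
by [].
Qed.

Lemma g2_pairing_le3 x y : `|(g2_coroot x *m g2_root y) 0 0| <= 3.
Proof.
rewrite g2_rootE g2_corootE g2_dot mxE mulr1n.
have /g2_forall2/(_ x y) : forall2 (fun i b j c => `|dotp (cp i b) (rp j c)| <= 3).
  by vm_compute.
by [].
Qed.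

Lemma g2_root_inj : injective g2_root.
Proof.
move=> x y; rewrite !g2_rootE => /trmx_inj/g2_vec_inj/eqP.
have /g2_forall2/(_ x y)/implyP h : forall2 (fun i b j c =>
    (rp i b == rp j c) ==> (i == j) && (b == c)) by vm_compute.
by case: x y h => [i b] [j c] /= h /h /andP[/eqP/val_inj-> /eqP->].
Qed.

Lemma g2_coroot_inj : injective g2_coroot.
Proof.
move=> x y; rewrite !g2_corootE => /g2_vec_inj/eqP.
have /g2_forall2/(_ x y)/implyP h : forall2 (fun i b j c =>
    (cp i b == cp j c) ==> (i == j) && (b == c)) by vm_compute.
by case: x y h => [i b] [j c] /= h /h /andP[/eqP/val_inj-> /eqP->].
Qed.

Lemma g2_root_stable x y : exists k,
  reflection_mx (g2_root x) (g2_coroot x) *m g2_root y = g2_root k.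
Proof.
rewrite /reflection_mx mulmxBl mul1mx -mulmxA !g2_rootE g2_corootE g2_dot.
rewrite mul_mx_scalar -linearZ -linearB /= g2_sub.
have /g2_forall2/(_ x y)/g2_has[k /eqP hk] : forall2 (fun i b j c =>
  has1 (fun k d => rp k d == subp (rp j c) (rp i b) (dotp (cp i b) (rp j c)))).
  by vm_compute.
by exists k; rewrite g2_rootE hk.
Qed.

Lemma g2_coroot_stable x y : exists k,
  g2_coroot y *m reflection_mx (g2_root x) (g2_coroot x) = g2_coroot k.
Proof.
rewrite /reflection_mx mulmxBr mulmx1 mulmxA !g2_corootE g2_rootE g2_dot.
rewrite mul_scalar_mx g2_sub.
have /g2_forall2/(_ x y)/g2_has[k /eqP hk] : forall2 (fun i b j c =>
  has1 (fun k d => cp k d == subp (cp j c) (cp i b) (dotp (cp j c) (rp i b)))).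
  by vm_compute.
by exists k; rewrite g2_corootE hk.
Qed.

Definition G2_datum : root_datum := RootDatum g2_root_inj g2_coroot_inj
  g2_pairing2 g2_root_stable g2_coroot_stable
  (reduced_root g2_pairing2 g2_pairing_le3).

(* The weights a, 2a + b, a + b, -a, -2a - b, -a - b, 0 of the coordinates
   x_1, ..., x_7: those of each monomial of the cubic form add up to 0. *)
Definition g2_coordinate_weight (i : 'I_7) : 'cV[int]_2 :=
  (g2_vec (nth (0, 0) [:: (1, 0); (2, 1); (1, 1); (-1, 0); (-2, -1); (-1, -1);
                          (0, 0)] i))^T.

End G2Datum.

(* Weights of the coordinates x_1, ..., x_n, x_-1, ..., x_-n, preceded by x_0
   in odd size. *)
Definition even_coordinate_weight n (i : 'I_(n + n)) : 'cV[int]_n :=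
  match fintype.split i with
  | inl k => signed_weight (k, false)
  | inr k => signed_weight (k, true)
  end.

Definition odd_coordinate_weight n (i : 'I_(1 + (n + n))) : 'cV[int]_n :=
  match fintype.split i with
  | inl _ => 0
  | inr j => even_coordinate_weight j
  end.

(* The tropical reductive group of Phi is isomorphic to the subgroup S of
   GL_m(T), with y in M^_R acting by the diagonal matrix of its pairings with the
   weights [chi] of the coordinates, and with W acting by permutation matrices. *)
Definition matrix_description (R : realType) (Phi : root_datum) (m : nat)
    (chi : 'I_m -> 'cV[int]_(rd_rank Phi)) (S : set (tropGL R m)) : Prop :=
  exists f : trop_group R Phi -> tropGL R m,
    [/\ {morph f : g h / (g * h)%g},
        set_bij [set: trop_group R Phi] S f,
        forall y, f (TropGroup y 1%g) = GLdiag (fun i => real_pairing (chi i) y)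
      & forall w, exists s, f (TropGroup 0 w) = GLperm R s].

(* For PGL_n, where M^ = Z^n / Z(1,...,1) and [(sl_weight i)^T] is the class of
   e_i: the class of z in M^_R = R^n / R(1,...,1) acts by the class of D(z). *)
Definition PGL_description (R : realType) (n : nat) : Prop :=
  exists f : trop_group R (PGL_datum n) -> tropPGL R n,
    [/\ {morph f : g h / (g * h)%g},
        bijective f,
        forall z : 'I_n -> R,
          f (@TropGroup R (PGL_datum n) (\sum_i z i *: map_mx intr (sl_weight i)^T) 1%g) =
          cq_proj (GLdiag z)
      & forall w, exists s, f (TropGroup 0 w) = cq_proj (GLperm R s)].

(* Main.v *)
(** Every element of GL_m(T) is D(y) P_s for a unique y and a unique s, so a
    subgroup of GL_m(T) is given by conditions on y and s.  In each of the six
    cases the Weyl group permutes the weights of the coordinates, and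
    (y, w) |-> D(<chi_i, y>) P_w is injective because these weights are distinct
    and span the dual space.  It remains to see that the group in question
    consists of the D(y) P_s with y = (<chi_i, z>)_i for some z and with s realized
    by the Weyl group (for PGL_n, everything is taken modulo scalars).  Evaluating
    an invariant form at indicator vectors of its monomials shows that s permutes
    the monomials and that the sum of the y_i over each monomial is 0.  *)
Require Import Defs.
From mathcomp Require Import all_boot all_order all_fingroup all_algebra.
From mathcomp Require Import boolp classical_sets functions reals.
From mathcomp Require Import ring lra zify.

Set Implicit Arguments.
Unset Strict Implicit.
Unset Printing Implicit Defensive.

Import Order.TTheory GRing.Theory Num.Theory.

Local Open Scope ring_scope.

(** In T a sum is infinite only if all its terms are, and sums are idempotent. The former makes
    invertible matrices monomial; the latter makes multiplicities irrelevant, so that q_2n and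
    q_2n+1 both become the minimum of x_i + x_(nu i) over all i, where nu negates indices. One
    analysis of the permutations commuting with nu thus serves Sp_2n, SO_2n+1 and SO_2n. For SO_2n
    the Weyl group is the even half of them: a single sign change is one transposition of the 2n
    coordinates, while every reflection is a product of two. The indicator test only shows that s
    maps some monomial into each given one; that this suffices follows from the involution for
    quadratic forms, and from a search through the 5040 permutations of seven coordinates for G_2.
    PGL_n stands apart: its matrices are known only modulo scalars, and the classes of the e_i are
    vectors of M^ rather than weights, so that transposes and inverse permutations enter. *)

(** * Monomial matrices over T *)

Section Monomial.
Variables (R : realType) (n : nat).
Notation T := (tropical R).
Implicit Types (y z : 'I_n -> R) (s t : 'S_n).

Lemma tropDD (a : T) : a + a = a.
Proof. by case: a => // a; congr Some; rewrite minxx. Qed.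

Lemma trop_mul_eq0 (a b : T) : a * b = 0 -> a = 0 \/ b = 0.
Proof. by case: a b => [a|] [b|] // _; [right | left | left]. Qed.

Lemma trop_sum_neq0 (I : finType) (F : I -> T) :
  \sum_i F i != 0 -> exists i, F i != 0.
Proof.
move=> h; apply/existsP; apply: contraR h => /existsPn h.
by rewrite big1 // => i _; have := h i; rewrite negbK => /eqP.
Qed.

(** There is no cancellation: a minimum is oo only if every term is. *)
Lemma trop_sum_eq0 (I : finType) (F : I -> T) i : \sum_i F i = 0 -> F i = 0.
Proof.
rewrite (bigD1 i) //=; case: (F i) => // x.
by case: (\sum_(_ | _) _).
Qed.

Lemma trop_prod (I : Type) (r : seq I) (F : I -> R) :
  \prod_(i <- r) trop (F i) = trop (\sum_(i <- r) F i).
Proof. by elim: r => [|i r IH]; rewrite ?big_nil // !big_cons IH. Qed.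

Definition GLmon y s : tropGL R n := (GLdiag y * GLperm R s)%g.

Lemma GLmonE y s i j :
  val (GLmon y s) i j = trop (y i) * (i == s j)%:R.
Proof.
rewrite mxE (bigD1 i) //= big1 => [|k ki].
  by rewrite !mxE eqxx mulr1n addr0.
by rewrite !mxE eq_sym (negPf ki) mulr0n mul0r.
Qed.

Lemma GLmon_mulmx p y s (B : 'M[T]_(n, p)) i j :
  (val (GLmon y s) *m B) i j = trop (y i) * B (s^-1%g i) j.
Proof.
rewrite mxE (bigD1 (s^-1%g i)) //= big1 => [|k ki].
  by rewrite GLmonE permKV eqxx mulr1 addr0.
rewrite GLmonE (_ : (i == s k) = false) ?mulr0 ?mul0r //.
by apply/eqP => e; rewrite e permK eqxx in ki.
Qed.

(** The permutations appear in reverse order because their product composes from left to right. *)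
Lemma GLmonM y s z t :
  (GLmon y s * GLmon z t)%g = GLmon (fun i => y i + z (s^-1%g i)) (t * s)%g.
Proof.
apply: val_inj; apply/matrixP => i j.
rewrite [LHS]GLmon_mulmx !GLmonE permM mulrA; congr (_ * _%:R).
by congr (nat_of_bool _); apply/eqP/eqP => [<-|->]; rewrite ?permK ?permKV.
Qed.

Lemma GLmon1 y : GLmon y 1%g = GLdiag y.
Proof.
apply: val_inj; apply/matrixP => i j; rewrite GLmonE perm1 !mxE.
by case: eqP => _; rewrite ?mulr1 ?mulr0.
Qed.

Lemma GLmon0 s : GLmon (fun=> 0) s = GLperm R s.
Proof. by apply: val_inj; apply/matrixP => i j; rewrite GLmonE mul1r mxE. Qed.

Lemma GLmon_inj y s z t : GLmon y s = GLmon z t -> y =1 z /\ s = t.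
Proof.
move=> e; have h i j := congr1 (fun A : tropGL R n => val A i j) e.
have st : s = t.
  apply/permP => j; apply/eqP; apply: contraT => /negPf ne.
  by have := h (s j) j; rewrite !GLmonE eqxx ne mulr1 mulr0.
split=> // i; have := h i (s^-1%g i).
by rewrite !GLmonE -st permKV eqxx !mulr1 => -[].
Qed.

Lemma eq_GLmon y z s : y =1 z -> GLmon y s = GLmon z s.
Proof. by move=> /funext->. Qed.

(* If A B = B A = I then, for every i, some A_ik and B_ki are finite; the latter
   makes all other entries in row i and column k of A infinite. *)
Lemma GLmon_ex (A : tropGL R n) : exists y s, A = GLmon y s.
Proof.
have /asboolP[B [AB BA]] := valP A.
have row i : exists k, (val A i k != 0) && (B k i != 0).
  have : \sum_k val A i k * B k i != 0.
    by have /matrixP/(_ i i) := AB; rewrite !mxE eqxx => ->.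
  move=> /trop_sum_neq0[k h]; exists k; apply: contraR h.
  by case/nandP => /negPn/eqP->; rewrite ?mul0r ?mulr0.
have /choice[t ht] := row.
have rowU i j : val A i j != 0 -> j = t i.
  move=> Aij; apply/eqP; apply: contraT => jt.
  have : \sum_l B (t i) l * val A l j = 0.
    by have /matrixP/(_ (t i) j) := BA; rewrite !mxE eq_sym (negPf jt).
  move=> /(@trop_sum_eq0 _ _ i)/trop_mul_eq0.
  by have /andP[_ /eqP h] := ht i; case=> // h'; rewrite h' eqxx in Aij.
have t_inj : injective t.
  move=> i i' e; apply/eqP; apply: contraT => ii'.
  have : \sum_l val A i l * B l i' = 0.
    by have /matrixP/(_ i i') := AB; rewrite !mxE (negPf ii').
  move=> /(@trop_sum_eq0 _ _ (t i))/trop_mul_eq0.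
  have /andP[/eqP h _] := ht i; have /andP[_ /eqP h'] := ht i'.
  by case=> // h''; rewrite e in h''.
have val_ex i : exists c : R, val A i (t i) = trop c.
  by have /andP[+ _] := ht i; case: (val A i (t i)) => [c|//]; exists c.
have /choice[y hy] := val_ex.
(* [t] sends a row to the column of its finite entry, whereas P_s has the finite entry of column j
   in row s j; hence the inverse. *)
exists y, (perm t_inj)^-1%g; apply: val_inj; apply/matrixP => i j.
rewrite GLmonE; case: eqP => [->|ij].
  by rewrite mulr1 -hy -[t _](permE t_inj) permKV.
rewrite mulr0; apply/eqP; apply: contraT => /rowU e.
by case: ij; rewrite e -(permE t_inj) permK.
Qed.

(** The finite entry of row i lies in column s^-1 i, so only the term of s^-1 is finite. *)
Lemma trop_det_GLmon y s : trop_det (val (GLmon y s)) = trop (\sum_i y i).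
Proof.
rewrite /trop_det (bigD1 s^-1%g) //= [X in _ + X]big1 => [|t ts].
  rewrite addr0 -trop_prod; apply: eq_bigr => i _.
  by rewrite GLmonE permKV eqxx mulr1.
have [i hi] : exists i, s (t i) != i.
  apply/existsP; apply: contraR ts => /existsPn h.
  apply/eqP/permP => i; apply: (@perm_inj _ s).
  by rewrite permKV; have := h i; rewrite negbK => /eqP.
by rewrite (bigD1 i) //= GLmonE eq_sym (negPf hi) mulr0 mul0r.
Qed.

Lemma tropSL_GLmon y s : @tropSL R n (GLmon y s) <-> \sum_i y i = 0.
Proof.
by rewrite /tropSL /= trop_det_GLmon; split=> [[]|->].
Qed.

(** Commuting with the diagonal matrix with real entry 1 in place j and 0 in the others forces s j =
    j; commuting with the transposition of i0 and i forces y i = y i0. *)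
Lemma gcenter_tropGL : @gcenter (tropGL R n) = @GLscalar R n.
Proof.
apply/seteqP; split=> A /=; last first.
  case=> a -> B; have [y [s ->]] := GLmon_ex B; rewrite /commute -!GLmon1 !GLmonM.
  by rewrite mul1g mulg1; apply: eq_GLmon => i; rewrite addrC invg1 perm1.
have [y [s ->]] := GLmon_ex A => cA.
have s1 : s = 1%g.
  apply/permP => j; rewrite perm1; apply/eqP; apply: contraT => /negPf sj.
  have := cA (GLdiag (fun i => (i == j)%:R)); rewrite /commute -GLmon1 !GLmonM.
  move=> /GLmon_inj[/(_ (s j)) + _].
  by rewrite permK eqxx sj invg1 perm1 add0r => /eqP; rewrite -subr_eq0 addrC addKr oner_eq0.
rewrite s1 GLmon1.
case: (pickP 'I_n) => [i0 _|n0]; last first.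
  (* In size 0 there is no entry to read the scalar from, and any scalar will do. *)
  by exists 0; congr GLdiag; apply/funext => i; have := n0 i.
exists (y i0); congr GLdiag; apply/funext => i.
have := cA (GLperm R (tperm i0 i)); rewrite /commute -GLmon0 !GLmonM.
move=> /GLmon_inj[/(_ i) + _].
by rewrite tpermV tpermR addr0 add0r.
Qed.

End Monomial.

(** * Weyl groups acting on coordinate weights *)

Section Weights.
Variables (Phi : root_datum) (m : nat) (chi : 'I_m -> 'cV[int]_(rd_rank Phi)).
Implicit Types (w : 'M[int]_(rd_rank Phi)) (s : 'S_m).

Definition permutes_weights w s := forall i, w *m chi i = chi (s i).

Lemma permutes_weights1 : permutes_weights 1%:M 1%g.
Proof. by move=> i; rewrite mul1mx perm1. Qed.

Lemma permutes_weightsM w s w' s' : permutes_weights w s ->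
  permutes_weights w' s' -> permutes_weights (w *m w') (s' * s)%g.
Proof. by move=> h h' i; rewrite -mulmxA h' h permM. Qed.

Lemma permutes_weightsV w s : w \in unitmx -> permutes_weights w s ->
  permutes_weights (invmx w) s^-1%g.
Proof. by move=> uw h i; rewrite -{1}[i](permKV s) -h mulKmx. Qed.

(** The property [P] lets one induction serve three purposes: mere existence of s, evenness of s for
    SO_2n, and preservation of the monomials for G_2. *)
Lemma in_weyl_permutes (P : 'S_m -> Prop) :
    P 1%g -> (forall s t, P s -> P t -> P (s * t)%g) ->
    (forall s, P s -> P s^-1%g) ->
    (forall p, exists2 s, P s &
      permutes_weights (reflection_mx (rd_root p) (rd_coroot p)) s) ->
  forall w, in_weyl w -> exists2 s, P s & permutes_weights w s.
Proof.
move=> P1 PM PV Prefl w; elim=> {w} [|//|w w' _ [s Ps hs] _ [t Pt ht]|w hw [s Ps hs]].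
- by exists 1%g => //; apply: permutes_weights1.
- by exists (t * s)%g; [apply: PM | apply: permutes_weightsM].
by exists s^-1%g; [apply: PV | apply: permutes_weightsV => //; apply: in_weyl_unit].
Qed.

Section Description.
Variables (R : realType) (S : set (tropGL R m)).
Hypothesis chi_inj : injective chi.
Hypothesis chi_nondegenerate : forall y : 'rV[R]_(rd_rank Phi),
  (forall i, real_pairing (chi i) y = 0) -> y = 0.
Hypothesis reflection_permutes : forall p, exists s,
  permutes_weights (reflection_mx (rd_root p) (rd_coroot p)) s.
Hypothesis S_GLmon : forall y s, S (GLmon y s) <->
  (exists z, forall i, y i = real_pairing (chi i) z) /\
  (exists2 w, in_weyl w & permutes_weights w s).

(** The rows of w - w' are integral vectors of M^ that pair to 0 with all weights, so they vanish
    after extension to R. *)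
Lemma permutes_weights_inj w w' s :
  permutes_weights w s -> permutes_weights w' s -> w = w'.
Proof.
move=> h h'; apply/row_matrixP => k; apply/eqP; rewrite -subr_eq0; apply/eqP.
set v := _ - _; have v_chi i : v *m chi i = 0.
  by rewrite mulmxBl -!row_mul h h' subrr.
have v0 : map_mx intr v = 0 :> 'rV[R]_ _.
  apply: chi_nondegenerate => i.
  by rewrite /real_pairing -map_mxM v_chi map_mx0 mxE.
by apply/rowP => l; have /rowP/(_ l)/eqP := v0; rewrite !mxE intr_eq0 => /eqP.
Qed.

Lemma permutes_weights_perm_inj w s s' :
  permutes_weights w s -> permutes_weights w s' -> s = s'.
Proof. by move=> h h'; apply/permP => i; apply: chi_inj; rewrite -h -h'. Qed.

(** This is <chi_i, w y> = <w^-1 chi_i, y>. *)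
Lemma real_pairing_weyl_act (w : weyl_group Phi) s i (y : 'rV[R]_(rd_rank Phi)) :
  permutes_weights (val w) s ->
  real_pairing (chi i) (weyl_act w y) = real_pairing (chi (s^-1%g i)) y.
Proof.
move=> h; rewrite /real_pairing /weyl_act -mulmxA -map_mxM.
by rewrite (permutes_weightsV (weyl_unit w) h).
Qed.

(** Distinctness of the weights makes s a function [sg] of w that reverses products, just as
    [GLmonM] does, so f is a morphism. Nondegeneracy recovers both y and w from the matrix, and
    [S_GLmon] identifies the image. *)
Lemma weights_matrix_description : matrix_description chi S.
Proof.
have perm_ex (w : weyl_group Phi) : exists s, permutes_weights (val w) s.
  have [||||s _ hs] := @in_weyl_permutes (fun=> True) _ _ _ _ _ (asboolW (valP w)) => //.
    by move=> p; have [s] := reflection_permutes p; exists s.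
  by exists s.
have /choice[sg hsg] := perm_ex.
pose D y i : R := real_pairing (chi i) y.
pose f (g : trop_group R Phi) := GLmon (D (tg_trans g)) (sg (tg_weyl g)).
have sg1 : sg 1%g = 1%g.
  exact: (permutes_weights_perm_inj (w := 1%:M) (hsg 1%g) permutes_weights1).
have sgM (v w : weyl_group Phi) : sg (v * w)%g = (sg w * sg v)%g.
  exact: (permutes_weights_perm_inj (hsg (v * w)%g) (permutes_weightsM (hsg v) (hsg w))).
exists f; split.
- move=> [y v] [z w]; rewrite /f GLmonM /= sgM; apply: eq_GLmon => i.
  by rewrite /D /= -(real_pairing_weyl_act _ _ (hsg v)) /real_pairing mulmxDl mxE.
- split.
  + move=> [y w] _; apply/S_GLmon; split; first by exists y.
    by exists (val w); [exact: asboolW (valP w) | apply: hsg].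
  + move=> [y v] [z w] _ _ /GLmon_inj[/= yz vw].
    have -> : y = z.
      apply/eqP; rewrite -subr_eq0; apply/eqP/chi_nondegenerate => i.
      have := yz i; rewrite /D /real_pairing => e.
      by rewrite mulmxBl [LHS]mxE [X in _ + X]mxE e subrr.
    congr TropGroup; apply: val_inj; apply: permutes_weights_inj (hsg v) _.
    by rewrite vw; apply: hsg.
  + move=> A; have [y [s ->]] := GLmon_ex A => /S_GLmon[[z yz] [w hw hs]].
    pose w' : weyl_group Phi := exist _ w (asboolT hw).
    exists (TropGroup z w') => //; rewrite /f /=.
    rewrite (permutes_weights_perm_inj (hsg w') hs).
    by apply: eq_GLmon => i; rewrite yz.
- by move=> y; rewrite /f /= sg1 GLmon1.
move=> w; exists (sg w); rewrite /f -GLmon0; apply: eq_GLmon => i.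
by rewrite /D /real_pairing mul0mx mxE.
Qed.

End Description.
End Weights.

(** * The Weyl group of the dual root datum *)

Section DualWeyl.
Variables (Phi : root_datum) (reduced : reduced_vectors (@rd_coroot Phi)).

(** The reflections of the dual datum are the transposes of those of the datum. *)
Lemma in_weyl_dual (w : 'M[int]_(rd_rank Phi)) :
  @in_weyl (dual_datum reduced) w -> @in_weyl Phi w^T.
Proof.
elim=> {w} [|p|w w' _ hw _ hw'|w _ hw] /=.
- by rewrite trmx1; apply: in_weyl1.
- by rewrite dual_reflection trmxK; apply: in_weyl_refl.
- by rewrite trmx_mul; apply: in_weylM.
by rewrite trmx_inv; apply: in_weylV.
Qed.

Lemma dual_in_weyl (w : 'M[int]_(rd_rank Phi)) :
  @in_weyl Phi w -> @in_weyl (dual_datum reduced) w^T.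
Proof.
elim=> {w} [|p|w w' _ hw _ hw'|w _ hw] /=.
- by rewrite trmx1; apply: (@in_weyl1 (dual_datum reduced)).
- by rewrite -dual_reflection; apply: (@in_weyl_refl (dual_datum reduced)).
- by rewrite trmx_mul; apply: (@in_weylM (dual_datum reduced)).
by rewrite trmx_inv; apply: (@in_weylV (dual_datum reduced)).
Qed.

End DualWeyl.

(** * The special linear group *)

Section SL.
Variable n : nat.

Lemma sl_reflection_weight (p : sl_index n) :
  @permutes_weights (SL_datum n) n (@sl_weight n)
    (reflection_mx (sl_root p) (sl_coroot p)) (tperm (val p).1 (val p).2).
Proof.
move=> i; rewrite /reflection_mx mulmxBl mul1mx -mulmxA.
rewrite [sl_coroot p *m _]mulmxBl !sl_pairing.
rewrite -raddfB /= mul_mx_scalar -tperm_diff; congr (_ - _ *: _).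
by rewrite !(eq_sym i) opprB addrA subrK.
Qed.

(** Every permutation is a product of transpositions, and that of i and j is induced by the
    reflection in e_i - e_j. *)
Lemma sl_weyl_perm (s : 'S_n) : exists2 w, @in_weyl (SL_datum n) w &
  @permutes_weights (SL_datum n) n (@sl_weight n) w s.
Proof.
have [ts -> /allP dts] := prod_tpermP s.
elim: ts dts => [|[i j] ts IH] dts.
  by rewrite big_nil; exists 1%:M; [apply: in_weyl1 | apply: permutes_weights1].
have [w hw hs] := IH (fun t ht => dts t (mem_behead (s := _ :: ts) ht)).
have ij : i != j by have := dts (i, j) (mem_head _ _).
pose p : sl_index n := exist (fun q : 'I_n * 'I_n => is_true (q.1 != q.2)) (i, j) ij.
rewrite big_cons; exists (w *m reflection_mx (sl_root p) (sl_coroot p)).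
  exact: in_weylM hw (@in_weyl_refl (SL_datum n) p).
exact: permutes_weightsM hs (sl_reflection_weight p).
Qed.

Lemma sl_weyl_permutes w : @in_weyl (SL_datum n) w ->
  exists s, @permutes_weights (SL_datum n) n (@sl_weight n) w s.
Proof.
move=> /(@in_weyl_permutes (SL_datum n) n (@sl_weight n) (fun=> True)).
case=> // [p|s _ hs]; last by exists s.
by exists (tperm (val p).1 (val p).2) => //; apply: sl_reflection_weight.
Qed.

Lemma sl_weight_inj : injective (@sl_weight n).
Proof.
move=> i j e; apply/eqP; apply: contraT => ij.
have h k : (sl_coweight k *m sl_weight i) 0 0 = (sl_coweight k *m sl_weight j) 0 0.
  by rewrite e.
(* With a and b telling whether i and j are last, the pairings give 1 - a = - b and - a = 1 - b;
   subtracting yields 1 = -1. *)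
have := h i; have := h j; rewrite !sl_pairing !mxE !eqxx (eq_sym j) (negPf ij) /=.
by lia.
Qed.

End SL.

Section TropicalSL.
Variables (R : realType) (n : nat).

Lemma widen_pred_max (k : 'I_n.-1) : (widen_ord (leq_pred n) k == n.-1 :> nat) = false.
Proof. by rewrite /= ltn_eqF. Qed.

Lemma real_pairing_sl_weight (y : 'rV[R]_n.-1) k :
  @real_pairing R (SL_datum n) (sl_weight (widen_ord (leq_pred n) k)) y = y 0 k.
Proof.
rewrite /real_pairing mxE (bigD1 k) //= big1 => [|l lk].
  by rewrite !mxE widen_pred_max /= eqxx subr0 mulr1 addr0.
by rewrite !mxE widen_pred_max /= val_eqE (negPf lk) mulr0.
Qed.

Lemma sl_weight_nondegenerate (y : 'rV[R]_(rd_rank (SL_datum n))) :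
  (forall i : 'I_n, @real_pairing R (SL_datum n) (sl_weight i) y = 0) -> y = 0.
Proof. by move=> h; apply/rowP => k; rewrite mxE -(real_pairing_sl_weight y k) h. Qed.

(** The e_i add up to 0 in M: each coordinate k receives 1 from the weight of index k and -1 from
    the last one. *)
Lemma sum_real_pairing_sl_weight (y : 'rV[R]_n.-1) :
  \sum_i @real_pairing R (SL_datum n) (@sl_weight n i) y = 0.
Proof.
rewrite /real_pairing (eq_bigr (fun i => \sum_k y 0 k * (sl_weight i k 0)%:~R)).
  rewrite exchange_big big1 // => k _; rewrite -mulr_sumr -raddf_sum /=.
  rewrite (_ : \sum_i _ = 0) ?mulr0 //; under eq_bigr do rewrite mxE.
  rewrite sumrB (bigD1 (widen_ord (leq_pred n) k)) //= eqxx big1 => [|i]; last first.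
    by rewrite -val_eqE /= eq_sym => /negPf->.
  have ln : (n.-1 < n)%N by have := ltn_ord k; lia.
  rewrite (bigD1 (Ordinal ln)) //= eqxx big1 => [|i]; last first.
    by rewrite -val_eqE /= => /negPf->.
  by rewrite !addr0 subrr.
by move=> i _; rewrite mxE; apply: eq_bigr => k _; rewrite mxE.
Qed.

Lemma sl_diag_ex (z : 'I_n -> R) : \sum_i z i = 0 <->
  exists y, forall i, z i = @real_pairing R (SL_datum n) (sl_weight i) y.
Proof.
split=> [z0|[y hy]]; last first.
  by rewrite (eq_bigr _ (fun i _ => hy i)) sum_real_pairing_sl_weight.
pose y : 'rV[R]_n.-1 := \row_k z (widen_ord (leq_pred n) k).
(* The defect [d] is 0 on the first n - 1 indices by the choice of y, and on the last one because it
   sums to 0. *)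
pose d i := z i - @real_pairing R (SL_datum n) (sl_weight i) y.
have d0 (k : 'I_n.-1) : d (widen_ord (leq_pred n) k) = 0.
  by rewrite /d real_pairing_sl_weight mxE subrr.
have sum_d : \sum_i d i = 0 by rewrite sumrB z0 sum_real_pairing_sl_weight subrr.
exists y => i; apply/eqP; rewrite -subr_eq0 -/(d i); apply/eqP.
have [ilt|] := ltnP i n.-1.
  by rewrite -(d0 (Ordinal ilt)); congr d; apply: val_inj.
move=> ige; move: sum_d; rewrite (bigD1 i) //= big1 ?addr0 // => j ji.
have jlt : (j < n.-1)%N.
  by move: ji; rewrite -val_eqE /=; have := ltn_ord i; have := ltn_ord j; lia.
by rewrite -(d0 (Ordinal jlt)); congr d; apply: val_inj.
Qed.

Lemma SL_matrix_description :
  @matrix_description R (SL_datum n) n (@sl_weight n) (@tropSL R n).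
Proof.
apply: (@weights_matrix_description (SL_datum n)).
- exact: sl_weight_inj.
- exact: sl_weight_nondegenerate.
- by move=> p; exists (tperm (val p).1 (val p).2); apply: sl_reflection_weight.
move=> z s; split=> [/tropSL_GLmon/sl_diag_ex hz|[hz _]].
  by split=> //; apply: sl_weyl_perm.
by apply/tropSL_GLmon/sl_diag_ex.
Qed.

End TropicalSL.

(** * The projective linear group *)

Section TropicalPGL.
Variables (R : realType) (n : nat).
Notation Phi := (PGL_datum n.+1).

(** The image of z in R^(n+1) / R(1, ..., 1). The size is a successor so that [ord_max] is available
    as the last coordinate, relative to which classes are normalized. *)
Definition pgl_class (z : 'I_n.+1 -> R) : 'rV[R]_(rd_rank Phi) :=
  \sum_i z i *: map_mx intr (sl_weight i)^T.

Lemma pgl_classE z (k : 'I_n) :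
  pgl_class z 0 k = z (widen_ord (leqnSn n) k) - z ord_max.
Proof.
rewrite summxE; under eq_bigr do rewrite !mxE /= rmorphB /= !rmorph_nat mulrBr.
rewrite sumrB; congr (_ - _); last first.
  rewrite big_ord_recr /= eqxx mulr1 big1 ?add0r // => i _.
  by rewrite (ltn_eqF (ltn_ord i)) mulr0.
rewrite (bigD1 (widen_ord (leqnSn n) k)) //= eqxx mulr1 big1 ?addr0 // => i.
by rewrite -val_eqE /= eq_sym => /negPf->; rewrite mulr0.
Qed.

Lemma pgl_class_inj z z' :
  pgl_class z = pgl_class z' <-> exists c, forall i, z' i = z i + c.
Proof.
split=> [/rowP e|[c h]]; last by apply/rowP => k; rewrite !pgl_classE !h; ring.
exists (z' ord_max - z ord_max) => i.
have [k ->|->] := unliftP ord_max i; last by ring.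
have -> : lift ord_max k = widen_ord (leqnSn n) k.
  by apply: val_inj; rewrite /= /bump leqNgt ltn_ord.
by have := e k; rewrite !pgl_classE; lra.
Qed.

Lemma pgl_class_ex (y : 'rV[R]_(rd_rank Phi)) : exists z, pgl_class z = y.
Proof.
exists (fun i => if unlift ord_max i is Some k then y 0 k else 0).
apply/rowP => k; rewrite pgl_classE unlift_none subr0.
have -> : widen_ord (leqnSn n) k = lift ord_max k.
  by apply: val_inj; rewrite /= /bump leqNgt ltn_ord.
by rewrite liftK.
Qed.

Lemma pgl_classD y z : pgl_class y + pgl_class z = pgl_class (fun i => y i + z i).
Proof. by rewrite -big_split; apply: eq_bigr => i _; rewrite /= -scalerDl. Qed.

Lemma cq_GLmon (z z' : 'I_n.+1 -> R) s s' :
  cq_proj (GLmon z s) = cq_proj (GLmon z' s') <->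
  s = s' /\ exists c, forall i, z' i = z i + c.
Proof.
rewrite cq_projP gcenter_tropGL; split=> [[c h]|[<- [c h]]].
  have := congr1 (fun A => (GLmon z s * A)%g) h.
  rewrite mulgA mulgV mul1g -GLmon1 GLmonM mul1g => /GLmon_inj[hz ->].
  by split=> //; exists c.
exists c; apply: (can_inj (mulKg (GLmon z s))).
by rewrite mulgA mulgV mul1g -GLmon1 GLmonM mul1g; apply: eq_GLmon.
Qed.

(** The transpose of w lies in the Weyl group of SL and permutes the classes of the e_i by s. The
    action on M^ uses w^-1, so it permutes them by s^-1 and the coefficients by s. *)
Lemma pgl_weyl_act (w : weyl_group Phi) s z :
  @permutes_weights (SL_datum n.+1) _ (@sl_weight n.+1) (val w)^T s ->
  weyl_act w (pgl_class z) = pgl_class (fun i => z (s i)).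
Proof.
move=> h; rewrite /weyl_act mulmx_suml [RHS](reindex_inj (@perm_inj _ s^-1%g)) /=.
apply: eq_bigr => i _; rewrite permKV -scalemxAl -map_mxM; congr (_ *: map_mx _ _).
have uw : (val w)^T \in unitmx by rewrite unitmx_tr; apply: weyl_unit.
by rewrite -(permutes_weightsV uw h) trmx_mul -trmx_inv trmxK.
Qed.

Lemma PGL_matrix_description : PGL_description R n.+1.
Proof.
have perm_ex (w : weyl_group Phi) :
    exists s, @permutes_weights (SL_datum n.+1) _ (@sl_weight n.+1) (val w)^T s.
  by have := asboolW (valP w) => /in_weyl_dual/sl_weyl_permutes.
have /choice[sg hsg] := perm_ex; have /choice[L hL] := pgl_class_ex.
have sg_inj s s' w : @permutes_weights (SL_datum n.+1) _ (@sl_weight n.+1) w s ->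
    @permutes_weights (SL_datum n.+1) _ (@sl_weight n.+1) w s' -> s = s'.
  exact/permutes_weights_perm_inj/sl_weight_inj.
have sg1 : sg 1%g = 1%g.
  apply: sg_inj (hsg 1%g) _; rewrite /= trmx1; exact: permutes_weights1.
have sgM (v w : weyl_group Phi) : sg (v * w)%g = (sg v * sg w)%g.
  apply: sg_inj (hsg (v * w)%g) _; rewrite /= trmx_mul.
  exact: permutes_weightsM (hsg w) (hsg v).
(* Because of the transpose, [sg] preserves products whereas [GLmonM] reverses them; the inverse
   reconciles the two. [L] chooses a representative modulo constants, which the quotient forgets. *)
pose f (g : trop_group R Phi) : tropPGL R n.+1 :=
  cq_proj (GLmon (L (tg_trans g)) (sg (tg_weyl g))^-1%g).
have f_inj : injective f.
  move=> [y v] [z w] /cq_GLmon[/= /invg_inj e] /pgl_class_inj.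
  rewrite !hL => ->; congr TropGroup; apply/val_inj/trmx_inj.
  have hw := hsg w; rewrite -e in hw.
  exact: (permutes_weights_inj (Phi := SL_datum n.+1)
    (@sl_weight_nondegenerate R n.+1) (hsg v) hw).
have f_surj u : exists g, f g = u.
  rewrite -(cq_projK u); have [z [s ->]] := GLmon_ex (generic_quotient.repr u).
  have [w hw hs] := sl_weyl_perm s^-1%g.
  have {}hw := @dual_in_weyl (SL_datum n.+1)
    (reduced_coroot (@sl_pairing2 n.+1) (@sl_pairing_le2 n.+1)) w hw.
  pose w' : weyl_group Phi := exist _ w^T (asboolT hw).
  exists (TropGroup (pgl_class z) w'); apply/cq_GLmon; split.
    by rewrite -[s]invgK; congr (_^-1)%g; apply: sg_inj (hsg w') _; rewrite /= trmxK.
  by apply/pgl_class_inj; rewrite hL.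
have /choice[h fh] := f_surj.
exists f; split.
- move=> [y v] [z w]; rewrite /f /= -[RHS]/(cq_mul _ _) cq_mulE GLmonM sgM invgM.
  apply/cq_GLmon; split=> //; apply/pgl_class_inj.
  rewrite hL -pgl_classD hL invgK; congr (_ + _).
  by rewrite -[in LHS](hL z) (pgl_weyl_act _ (hsg v)).
- by exists h => // g; apply: f_inj; rewrite fh.
- move=> z; rewrite -GLmon1; apply/cq_GLmon; rewrite /= sg1 invg1; split=> //.
  by apply/pgl_class_inj; rewrite hL.
move=> w; exists (sg w)^-1%g; rewrite -GLmon0; apply/cq_GLmon; split=> //.
apply/pgl_class_inj; rewrite hL /pgl_class big1 // => i _.
by rewrite scale0r.
Qed.

End TropicalPGL.

(** * Tropical forms and their stabilizers *)

Section TropicalForm.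
Variables (R : realType) (m : nat) (L : seq (seq 'I_m)).
Notation T := (tropical R).
Implicit Types (s t : 'S_m) (l : seq 'I_m).

Definition trop_form (x : 'cV[T]_m) : T := \sum_(l <- L) \prod_(i <- l) x i 0.

Definition preserves_monomials s :=
  forall l, l \in L -> exists2 l', l' \in L & perm_eq (map s l') l.

Lemma preserves_monomials1 : preserves_monomials 1%g.
Proof. by move=> l Ll; exists l; rewrite // (eq_map (@perm1 _)) map_id. Qed.

Lemma preserves_monomialsM s t : preserves_monomials s -> preserves_monomials t ->
  preserves_monomials (s * t)%g.
Proof.
move=> hs ht l /ht[l' /hs[l'' L'' e''] e']; exists l'' => //.
apply: perm_trans e'; rewrite (eq_map (permM s t)) map_comp.
exact: perm_map.
Qed.

(** The order of s is finite, so its inverse is one of its powers. *)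
Lemma preserves_monomialsV s : preserves_monomials s -> preserves_monomials s^-1%g.
Proof.
move=> hs; rewrite invg_expg; elim: (_.-1) => [|k IH].
  exact: preserves_monomials1.
by rewrite expgS; apply: preserves_monomialsM.
Qed.

(** By idempotency a value that already occurs adds nothing; hence a tropical sum depends only on
    the set of its values, and monomials need not be matched bijectively. *)
Lemma trop_sum_absorb (I J : eqType) (r : seq I) (r' : seq J) (F : I -> T) (G : J -> T) :
  (forall i, i \in r -> exists2 j, j \in r' & F i = G j) ->
  \sum_(i <- r) F i + \sum_(j <- r') G j = \sum_(j <- r') G j.
Proof.
elim: r => [|i r IH] h; first by rewrite big_nil add0r.
rewrite big_cons -addrA IH => [|k rk]; last by apply: h; rewrite inE rk orbT.
have [j r'j ->] := h i (mem_head _ _).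
by rewrite (big_rem j) //= addrA tropDD.
Qed.

Lemma trop_sum_eq (I J : eqType) (r : seq I) (r' : seq J) (F : I -> T) (G : J -> T) :
  (forall i, i \in r -> exists2 j, j \in r' & F i = G j) ->
  (forall j, j \in r' -> exists2 i, i \in r & G j = F i) ->
  \sum_(i <- r) F i = \sum_(j <- r') G j.
Proof. by move=> /trop_sum_absorb <- /trop_sum_absorb; rewrite addrC => ->. Qed.

Lemma trop_sum_const (I : eqType) (r : seq I) (F : I -> T) c i : i \in r -> F i = c ->
  (forall j, j \in r -> F j = c \/ F j = 0) -> \sum_(j <- r) F j = c.
Proof.
move=> ri Fi h; rewrite (big_rem i) //= Fi.
have : forall j, j \in rem i r -> F j = c \/ F j = 0 by move=> j /mem_rem/h.
elim: (rem i r) => [|j r' IH] {}h; first by rewrite big_nil addr0.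
rewrite big_cons addrCA IH => [|k r'k]; last by apply: h; rewrite inE r'k orbT.
by case: (h j (mem_head _ _)) => ->; rewrite ?tropDD ?add0r.
Qed.

Lemma stabilizer_trop_form y s : (forall l, l \in L -> \sum_(i <- l) y i = 0) ->
  preserves_monomials s -> stabilizer trop_form (GLmon y s).
Proof.
move=> y0 hs x.
have -> : trop_form (val (GLmon y s) *m x) =
    \sum_(l <- L) \prod_(i <- l) x (s^-1%g i) 0.
  rewrite /trop_form big_seq [RHS]big_seq; apply: eq_bigr => l Ll.
  under eq_bigr do rewrite GLmon_mulmx.
  by rewrite big_split /= trop_prod y0 // mul1r.
apply: trop_sum_eq => l Ll.
  have [l' Ll' e] := hs l Ll; exists l' => //; rewrite -(perm_big _ e) big_map.
  by apply: eq_bigr => i _; rewrite permK.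
have [l' Ll' e] := preserves_monomialsV hs Ll; exists l' => //.
by rewrite -(perm_big _ e) big_map.
Qed.

(** In T the scalar b%:R is the real number 0 if b holds and oo otherwise. *)
Lemma trop_prod_indicator (A : pred 'I_m) l :
  \prod_(i <- l) (A i)%:R = (all A l)%:R :> T.
Proof.
elim: l => [|i l IH]; first by rewrite big_nil.
by rewrite big_cons IH /=; case: (A i); rewrite ?mul1r ?mul0r.
Qed.

(* Evaluate the form at the indicator of [l] transported by [s]. *)
Lemma trop_form_stabilizer y s :
  (forall l l', l \in L -> l' \in L -> {subset l' <= l} -> perm_eq l' l) ->
  stabilizer trop_form (GLmon y s) -> forall l, l \in L ->
  \sum_(i <- l) y i = 0 /\ exists2 l', l' \in L & {subset map s l' <= l}.
Proof.
move=> antichain h l Ll.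
pose x : 'cV[T]_m := \col_i (s i \in l)%:R.
have fAx : trop_form (val (GLmon y s) *m x) = trop (\sum_(i <- l) y i).
  have e l' : \prod_(i <- l') (val (GLmon y s) *m x) i 0 =
      trop (\sum_(i <- l') y i) * (all (mem l) l')%:R.
    rewrite -trop_prod -trop_prod_indicator -big_split.
    by apply: eq_bigr => i _; rewrite GLmon_mulmx mxE permKV.
  (* By the antichain condition, the finite terms come from rearrangements of l and all have the
     same value. *)
  apply: (trop_sum_const Ll) => [|l' Ll'].
    by rewrite e (introT allP) // mulr1.
  rewrite e; case: allP => [sub|_]; last by right; rewrite mulr0.
  by left; rewrite mulr1 (perm_big _ (antichain _ _ Ll Ll' sub)).
have fx l' : \prod_(i <- l') x i 0 = (all (fun i => s i \in l) l')%:R.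
  by rewrite -trop_prod_indicator; apply: eq_bigr => i _; rewrite mxE.
have := h x; rewrite fAx.
(* At x the form can only be the real 0 or oo. It equals the finite sum of the y_i over l, so it is
   0 and some monomial l' is finite at x. *)
have [/hasP[l' Ll' sub]|/hasPn none] := boolP (has (all (fun i => s i \in l)) L).
  rewrite /trop_form (trop_sum_const (c := 1) Ll') => [[Y0]||l'' _].
  - split=> //; exists l' => // _ /mapP[i l'i ->].
    exact: (allP sub i l'i).
  - by rewrite fx sub.
  - by rewrite fx; case: all; [left | right].
rewrite [trop_form x](_ : _ = 0) // /trop_form big_seq big1 // => l' /none/negPf.
by rewrite fx => ->.
Qed.

End TropicalForm.

(** * Quadratic forms given by an involution of the indices *)

Section InvolutionForm.
Variables (R : realType) (m : nat) (nu : 'I_m -> 'I_m).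
Hypothesis nuK : involutive nu.
Hypothesis nu_fix_unique : forall i j, nu i = i -> nu j = j -> i = j.
Notation T := (tropical R).

(** A pair of exchanged indices is counted twice, which the minimum ignores, and a fixed index
    contributes a square, like x_0 in odd size. *)
Definition nu_form (x : 'cV[T]_m) : T := \sum_i x i 0 * x (nu i) 0.

Lemma nu_form_trop_form :
  nu_form = @trop_form R m [seq [:: i; nu i] | i <- enum 'I_m].
Proof.
apply/funext => x; rewrite /trop_form big_map big_enum.
by apply: eq_bigr => i _; rewrite !big_cons big_nil mulr1.
Qed.

Lemma nu_form_stabilizer y s : stabilizer nu_form (GLmon y s) <->
  (forall i, y (nu i) = - y i) /\ (forall i, s (nu i) = nu (s i)).
Proof.
have Lnu i : [:: i; nu i] \in [seq [:: i; nu i] | i <- enum 'I_m].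
  by apply/map_f; rewrite mem_enum.
rewrite nu_form_trop_form; split=> [h|[hy hs]]; last first.
  apply: stabilizer_trop_form => _ /mapP[i _ ->].
    by rewrite !big_cons big_nil hy; ring.
  by exists [:: s^-1%g i; nu (s^-1%g i)]; rewrite //= hs permKV.
have {h} hL i : y i + y (nu i) = 0 /\ exists j,
    s j \in [:: i; nu i] /\ s (nu j) \in [:: i; nu i].
  have [|+ [_ /mapP[j _ ->] sub]] := trop_form_stabilizer _ h (Lnu i).
    move=> _ _ /mapP[k _ ->] /mapP[j _ ->] sub.
    have : j \in [:: k; nu k] by apply: sub; rewrite inE eqxx.
    rewrite !inE => /orP[/eqP->|/eqP->] //.
    by rewrite nuK; apply/seq.permP => a /=; rewrite addnCA.
  rewrite !big_cons big_nil addr0 => ->; split=> //; exists j.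
  by split; apply: sub; rewrite !inE eqxx ?orbT.
split=> [i|k]; first by have [/eqP] := hL i; rewrite addr_eq0 => /eqP->; rewrite opprK.
have [_ [j [sj snj]]] := hL (s k).
have [ik|ik] := eqVneq (nu (s k)) (s k).
  by move: sj snj; rewrite !inE ik !orbb => /eqP/perm_inj -> /eqP ->.
(* If j were fixed by nu, the pair mapped into {j} would be a fixed point, hence j itself. Then s j
   = j, and s k would be fixed as well. *)
have jj : nu j != j.
  apply: contra_neq ik => jj.
  have [_ [j' [sj' snj']]] := hL j; move: sj' snj'.
  rewrite !inE jj !orbb => /eqP e /eqP; rewrite -e => /perm_inj /nu_fix_unique/(_ jj) e'.
  have sjj : s j = j by rewrite -{1}e'.
  move: sj; rewrite sjj !inE => /orP[] /eqP jE.
    by rewrite -jE.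
  by apply: (can_inj nuK); rewrite -jE jj.
have {}jj : s (nu j) != s j by rewrite (inj_eq (@perm_inj _ s)).
move: sj snj jj; rewrite !inE.
case/orP=> /eqP ej; rewrite ej => /orP[] /eqP enj; rewrite enj ?eqxx //.
  by move/perm_inj: ej enj => -> ->.
by move/perm_inj: enj => e _; rewrite -{1}e nuK ej.
Qed.

Lemma sum_nu_anti y : (forall i, y (nu i) = - y i) -> \sum_i y i = 0 :> R.
Proof.
move=> h; have := erefl (\sum_i y i); rewrite {1}(reindex_inj (can_inj nuK)) /=.
by rewrite (eq_bigr (fun i => - y i)) // sumrN; lra.
Qed.

End InvolutionForm.

(** * Permutations commuting with an involution *)

Section SignedPermutations.
Variables (m : nat) (nu : 'I_m -> 'I_m).
Hypothesis nuK : involutive nu.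
Hypothesis nu_fix_unique : forall i j, nu i = i -> nu j = j -> i = j.
Implicit Types (u v : 'I_m) (s : 'S_m).

(** For u distinct from v and nu v, and neither u nor v fixed by nu, this will be the effect on
    indices of the reflection in chi_u - chi_v. *)
Definition nu_tperm u v : 'S_m := (tperm u v * tperm (nu u) (nu v))%g.

Lemma nu_tpermE u v x : nu u != u -> nu v != v -> u != v -> u != nu v ->
  nu_tperm u v x = if x == u then v else if x == v then u
    else if x == nu u then nu v else if x == nu v then nu u else x.
Proof.
move=> uu vv uv unv; have nunv : nu u != nu v by rewrite (inj_eq (can_inj nuK)).
have nuv : nu u != v by apply: contraNneq unv => <-; rewrite nuK.
rewrite /nu_tperm permM; case: (tpermP u v x) => [->|->|/eqP/negPf xu /eqP/negPf xv].
- by rewrite eqxx tpermD.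
- by rewrite (eq_sym v) (negPf uv) eqxx tpermD // eq_sym.
rewrite xu xv; case: tpermP => [->|->|/eqP/negPf-> /eqP/negPf->] //.
  by rewrite eqxx.
by rewrite eqxx eq_sym (negPf nunv).
Qed.

Lemma nu_tpermK u v : nu u != u -> nu v != v -> u != v -> u != nu v ->
  (nu_tperm u v * nu_tperm u v)%g = 1%g.
Proof.
move=> uu vv uv unv; have nunv : nu u != nu v by rewrite (inj_eq (can_inj nuK)).
have nuv : nu u != v by apply: contraNneq unv => <-; rewrite nuK.
have e := nu_tpermE _ uu vv uv unv.
apply/permP => x; rewrite permM perm1 (e x).
case: ifP => [/eqP->|xu]; first by rewrite e eq_sym (negPf uv) eqxx.
case: ifP => [/eqP->|xv]; first by rewrite e eqxx.
case: ifP => [/eqP->|xnu].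
  by rewrite e (eq_sym _ u) (negPf unv) (negPf vv) (eq_sym _ (nu u)) (negPf nunv) eqxx.
case: ifP => [/eqP->|xnv]; first by rewrite e (negPf uu) (negPf nuv) eqxx.
by rewrite e xu xv xnu xnv.
Qed.

Lemma odd_nu_tperm u v : odd_perm (nu_tperm u v) = false.
Proof.
by rewrite /nu_tperm odd_permM !odd_tperm (inj_eq (can_inj nuK)) addbb.
Qed.

(* [tperm a (nu a)] is a sign change; a product of two of them is a product of
   the two reflections interchanging a with b and with - b. *)
Lemma nu_tperm2 u v : nu u != u -> nu v != v -> u != v -> u != nu v ->
  (tperm u (nu u) * tperm v (nu v) = nu_tperm u v * nu_tperm u (nu v))%g.
Proof.
move=> uu vv uv unv; have nunv : nu u != nu v by rewrite (inj_eq (can_inj nuK)).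
have nuv : nu u != v by apply: contraNneq unv => <-; rewrite nuK.
have vu : (v == u) = false by rewrite eq_sym (negPf uv).
have nvu : (nu v == u) = false by rewrite eq_sym (negPf unv).
have nvnu : (nu v == nu u) = false by rewrite eq_sym (negPf nunv).
have vnu : (v == nu u) = false by rewrite eq_sym (negPf nuv).
have vnv : (v == nu v) = false by rewrite eq_sym (negPf vv).
have unu : (u == nu u) = false by rewrite eq_sym (negPf uu).
have e := nu_tpermE _ uu vv uv unv.
have e' x : nu_tperm u (nu v) x = if x == u then nu v else if x == nu v then u
    else if x == nu u then v else if x == v then nu u else x.
  by rewrite nu_tpermE // nuK // eq_sym.
apply/permP => x; rewrite [LHS]permM [RHS]permM e.
have neqs := (negPf uu, negPf vv, negPf uv, negPf unv, negPf nunv, negPf nuv,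
  vu, nvu, nvnu, vnu, vnv, unu, eqxx).
case: (tpermP u (nu u) x) => [->|->|/eqP/negPf xu /eqP/negPf xnu].
- by rewrite eqxx e' !neqs tpermD // eq_sym.
- by rewrite !neqs e' !neqs tpermD // eq_sym.
rewrite xu xnu; case: tpermP => [->|->|/eqP/negPf xv /eqP/negPf xnv].
- by rewrite !neqs e' !neqs.
- by rewrite !neqs e' !neqs.
by rewrite xv xnv e' xu xnu xv xnv.
Qed.

(** Induction on the number of moved points. If s moves v to u, then composing with the sign change
    of v when u = nu v, and with [nu_tperm nu u v] otherwise, fixes a new point (nu v or u) and
    keeps the points already fixed. *)
Lemma signed_perm_ind (P : 'S_m -> Prop) :
    P 1%g ->
    (forall u s, nu u != u -> (forall i, s (nu i) = nu (s i)) ->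
      P s -> P (tperm u (nu u) * s)%g) ->
    (forall u v s, nu u != u -> nu v != v -> u != v -> u != nu v ->
      (forall i, s (nu i) = nu (s i)) -> P s -> P (nu_tperm u v * s)%g) ->
  forall s, (forall i, s (nu i) = nu (s i)) -> P s.
Proof.
move=> P1 Pt Pnt s; have [k] := ubnP #|[pred i | s i != i]|.
elim: k s => // k IH s; rewrite ltnS => sk hs.
have [v sv|s1] := pickP [pred i | s i != i]; last first.
  suff -> : s = 1%g by [].
  by apply/permP => i; rewrite perm1; have := s1 i => /= /negbT; rewrite negbK => /eqP.
rewrite /= in sv; have [u uE] : {u | u = s v} by exists (s v).
(* A point fixed by nu is sent by s to another such point, hence to itself. *)
have vv : nu v != v.
  apply: contraNneq sv => vv; apply/eqP/nu_fix_unique => //.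
  by rewrite -hs vv.
have uu : nu u != u.
  apply: contraNneq vv; rewrite uE -hs => /perm_inj->.
  by rewrite eqxx.
have uv : u != v by rewrite uE.
have moved s' : (forall x, s x = x -> s' x = x) -> (exists x, s' x = x /\ s x <> x) ->
    (#|[pred i | s' i != i]| < k)%N.
  move=> h [x [s'x sx]]; apply: leq_trans sk; apply: proper_card; apply/properP.
  split; last by exists x; rewrite inE; [apply/eqP | rewrite s'x eqxx].
  apply/fintype.subsetP => i; rewrite !inE; apply: contraNN => /eqP/h ->.
  by rewrite eqxx.
have su : s u <> u by rewrite {2}uE => /perm_inj/eqP; rewrite (negPf uv).
have sv' : s v <> v by apply/eqP.
have snu x : s x <> x -> s (nu x) <> nu x by move=> h; rewrite hs => /(can_inj nuK).
have [unv|unv] := eqVneq u (nu v).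
  have e : s = (tperm v (nu v) * (tperm v (nu v) * s))%g by rewrite mulgA tperm2 mul1g.
  have hs' i : (tperm v (nu v) * s)%g (nu i) = nu ((tperm v (nu v) * s)%g i).
    rewrite !permM -hs; congr (s _); case: tpermP => [iv|iv|].
    - by rewrite -(nuK i) iv tpermR.
    - by rewrite -(nuK i) iv nuK tpermL nuK.
    move=> /eqP niv /eqP ninv; rewrite tpermD //.
      by apply: contraNneq ninv => ->.
    by apply: contraNneq niv => <-; rewrite nuK.
  rewrite e; apply: Pt => //; apply: IH => //; apply: moved.
    move=> x sx; rewrite permM tpermD // eq_sym; apply/eqP => xv; move: sx; rewrite xv //.
    exact: snu.
  exists (nu v); rewrite permM tpermR -uE; split=> //; exact: snu.
have e : s = (nu_tperm u v * (nu_tperm u v * s))%g by rewrite mulgA nu_tpermK // mul1g.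
have tE := nu_tpermE _ uu vv uv unv.
have nunv : nu u != nu v by rewrite (inj_eq (can_inj nuK)).
have nuv : nu u != v by apply: contraNneq unv => <-; rewrite nuK.
have hs' i : (nu_tperm u v * s)%g (nu i) = nu ((nu_tperm u v * s)%g i).
  rewrite permM [in RHS]permM -hs; congr (s _); rewrite !tE.
  rewrite !(inj_eq (can_inj nuK)).
  have nuE j : (nu i == j) = (i == nu j) by rewrite -{1}(nuK j) (inj_eq (can_inj nuK)).
  rewrite !nuE.
  have [->|iu] := eqVneq i u; first by rewrite eq_sym (negPf uu) (negPf unv).
  have [->|iv] := eqVneq i v; first by rewrite eq_sym (negPf nuv) eq_sym (negPf vv).
  by case: ifP => _; [rewrite nuK | case: ifP => _; rewrite ?nuK].
rewrite e; apply: Pnt => //; apply: IH => //; apply: moved.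
  move=> x sx; rewrite permM tE.
  have nx w : s w <> w -> (x == w) = false by move=> sw; apply/eqP => xw; rewrite -xw in sw.
  by rewrite !nx //; apply: snu.
by exists u; rewrite permM tE eqxx.
Qed.

End SignedPermutations.

(** * Coordinates whose weights are 0 or signed basis vectors *)

Lemma snegK n : involutive (@sneg n).
Proof. by move=> [k b]; rewrite /sneg /= negbK. Qed.

Lemma signed_weight_inj n : injective (@signed_weight n).
Proof.
move=> a b e; have := signed_pairing a b; rewrite -e signed_pairing sdotxx.
move=> /matrixP/(_ 0 0); rewrite !mxE /sdot; case: (a =P b) => // _.
by case: (a =P sneg b) => _ /eqP.
Qed.

Lemma signed_weight_neq0 n (a : 'I_n * bool) : signed_weight a <> 0.
Proof.
move=> a0; have := signed_pairing a a; rewrite a0 mulmx0 sdotxx.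
by move=> /matrixP/(_ 0 0)/eqP; rewrite !mxE.
Qed.

Section SignedWeights.
Variables (n m : nat) (chi : 'I_m -> 'cV[int]_n) (nu : 'I_m -> 'I_m).
Hypothesis chi_inj : injective chi.
Hypothesis chi_nu : forall i, chi (nu i) = - chi i.
Hypothesis chi_signed : forall i, chi i = 0 \/ exists a, chi i = signed_weight a.
Hypothesis chi_onto : forall a, exists i, chi i = signed_weight a.

Lemma chi_nuK : involutive nu.
Proof. by move=> i; apply: chi_inj; rewrite !chi_nu opprK. Qed.

Lemma chi_nu_fix i : nu i = i <-> chi i = 0.
Proof.
split=> [e|e]; last by apply: chi_inj; rewrite chi_nu e oppr0.
have := chi_nu i; rewrite e => /matrixP h; apply/matrixP => a b.
by move: (h a b); rewrite !mxE; move: (chi i a b) => c; lia.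
Qed.

Lemma chi_nu_fix_unique i j : nu i = i -> nu j = j -> i = j.
Proof. by move=> /chi_nu_fix i0 /chi_nu_fix j0; apply: chi_inj; rewrite i0. Qed.

Lemma chi_moved i : nu i != i -> exists a, chi i = signed_weight a.
Proof. by move=> h; case: (chi_signed i) => // /chi_nu_fix e; rewrite e eqxx in h. Qed.

Lemma signed_moved i a : chi i = signed_weight a -> nu i != i.
Proof. by move=> ia; apply/eqP => /chi_nu_fix; rewrite ia; apply: signed_weight_neq0. Qed.

Lemma chi_sneg i a : chi i = signed_weight a -> chi (nu i) = signed_weight (sneg a).
Proof. by move=> e; rewrite chi_nu e signed_weightN. Qed.

Lemma chi_eq i j a b : chi i = signed_weight a -> chi j = signed_weight b ->
  (i == j) = (a == b).
Proof.
move=> ia jb; apply/eqP/eqP => [e|e]; last by apply: chi_inj; rewrite ia jb e.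
by apply: signed_weight_inj; rewrite -ia -jb e.
Qed.

Section Reflections.
Variable long : bool.
Notation Phi := (signed_datum long n).
Notation permutes := (@permutes_weights Phi m chi).

(** The root is chi_u - chi_v, so its reflection exchanges u and v. For a root 2 e_a this means v =
    nu u, and the reflection is a sign change. *)
Lemma signed_reflection_permutes (p : signed_index long n) u v :
    chi u = signed_weight (val p).1 -> chi v = signed_weight (sneg (val p).2) ->
  permutes (reflection_mx (signed_root p) (signed_coroot p))
    (if (val p).1 == (val p).2 then tperm u v else nu_tperm nu u v).
Proof.
have := signed_index_valid p.
move ea : (val p).1 => a; move eb : (val p).2 => b => ab ua vb i.
have uu := signed_moved ua; have vv := signed_moved vb.
have nua := chi_sneg ua; have nvb := chi_sneg vb; rewrite snegK in nvb.
have [ci|[c ic]] := chi_signed i.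
  rewrite ci mulmx0; have neq j d : chi j = signed_weight d -> (i == j) = false.
    by move=> jd; apply/eqP => e; move: jd; rewrite -e ci => /esym/signed_weight_neq0.
  case: ifP => [_|/negP/negP a_b]; first by rewrite tpermD // eq_sym (neq _ _ ua, neq _ _ vb).
  by rewrite permM !tpermD // eq_sym (neq _ _ ua, neq _ _ vb, neq _ _ nua, neq _ _ nvb).
rewrite ic signed_reflection_weight ea eb.
have [iu iv inu inv] : [/\ (i == u) = (c == a), (i == v) = (c == sneg b),
    (i == nu u) = (c == sneg a) & (i == nu v) = (c == b)].
  by split; apply: chi_eq.
rewrite /srefl; case: (eqVneq a b) ab => [e|ne] ab.
  have vE : v = nu u by apply: chi_inj; rewrite nua vb e.
  case: tpermP => [i_u|i_v|/eqP i_u /eqP i_v].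
  - by rewrite -iu i_u eqxx vb.
  - move: vv; rewrite vE chi_nuK -inu i_v vE eqxx -iu i_v vE => /negPf.
    by rewrite eq_sym => ->; rewrite ua e.
  by rewrite -e -iu -inu -vE (negPf i_u) (negPf i_v).
move: ab; rewrite andbF orbF => ab1.
have uv : u != v.
  by rewrite (chi_eq ua vb); apply: contraNneq ab1 => ->.
have unv : u != nu v by rewrite (chi_eq ua nvb).
have nuv : v != nu u by apply: contraNneq unv => ->; rewrite chi_nuK.
have nunv : nu u != nu v by rewrite (inj_eq (can_inj chi_nuK)).
rewrite (nu_tpermE chi_nuK) // -iu -iv -inu -inv.
have [|_] := eqVneq i u; first by rewrite vb.
have [->|_] := eqVneq i v; last by case: ifP => _; [rewrite nvb | case: ifP => _; rewrite ?nua].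
by rewrite (negPf nuv) eq_sym (negPf vv) ua.
Qed.

Definition realized s := exists2 w, @in_weyl Phi w & permutes w s.

Lemma realized1 : realized 1%g.
Proof. by exists 1%:M; [apply: in_weyl1 | apply: permutes_weights1]. Qed.

Lemma realizedM s t : realized s -> realized t -> realized (s * t)%g.
Proof.
move=> [w hw hs] [w' hw' ht]; exists (w' *m w); first exact: in_weylM.
exact: permutes_weightsM.
Qed.

Lemma realized_nu s i : realized s -> s (nu i) = nu (s i).
Proof.
by move=> [w _ h]; apply: chi_inj; rewrite -h !chi_nu mulmxN h.
Qed.

Lemma realized_nu_tperm u v : nu u != u -> nu v != v -> u != v -> u != nu v ->
  realized (nu_tperm nu u v).
Proof.
(* Roots involving two basis vectors are listed with increasing indices only, but [nu_tperm] is
   symmetric in u and v. *)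
suff h u' v' a b : chi u' = signed_weight a -> chi v' = signed_weight b ->
    (a.1 < b.1)%N -> realized (nu_tperm nu u' v').
  move=> /chi_moved[a ua] /chi_moved[b vb] uv unv.
  have := chi_eq ua (chi_sneg vb); have := chi_eq ua vb.
  rewrite (negPf uv) (negPf unv) => /esym ab /esym anb.
  have [lt|lt|e] := ltngtP a.1 b.1; first exact: h ua vb lt.
    by rewrite /nu_tperm tpermC [tperm (nu u) _]tpermC; apply: h vb ua lt.
  move: ab anb; case: a b e {ua vb} => [k c] [l d] /= /val_inj ->.
  by rewrite !xpair_eqE eqxx /=; case: c d => [] [].
move=> ua vb ab.
have hp : (a.1 < (sneg b).1)%N || long && (a == sneg b) by rewrite ab.
pose p : signed_index long n := exist (fun p : ('I_n * bool) * ('I_n * bool) =>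
  is_true ((p.1.1 < p.2.1)%N || long && (p.1 == p.2))) (a, sneg b) hp.
exists (reflection_mx (signed_root p) (signed_coroot p)).
  exact: (@in_weyl_refl Phi p).
have := @signed_reflection_permutes p u' v'; rewrite /= snegK => /(_ ua vb).
by case: eqP => // e; move: ab; rewrite e ltnn.
Qed.

Lemma realized_tperm u : long -> nu u != u -> realized (tperm u (nu u)).
Proof.
move=> hl /chi_moved[a ua].
have hp : (a.1 < a.1)%N || long && (a == a) by rewrite hl eqxx orbT.
pose p : signed_index long n := exist (fun p : ('I_n * bool) * ('I_n * bool) =>
  is_true ((p.1.1 < p.2.1)%N || long && (p.1 == p.2))) (a, a) hp.
exists (reflection_mx (signed_root p) (signed_coroot p)).
  exact: (@in_weyl_refl Phi p).
have := @signed_reflection_permutes p u (nu u); rewrite /= eqxx.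
by move=> /(_ ua (chi_sneg ua)).
Qed.

Lemma signed_reflection_ex (p : rd_index Phi) : exists s,
  permutes (reflection_mx (rd_root p) (rd_coroot p)) s.
Proof.
have [u hu] := chi_onto (val p).1; have [v hv] := chi_onto (sneg (val p).2).
exists (if (val p).1 == (val p).2 then tperm u v else nu_tperm nu u v).
exact: signed_reflection_permutes hu hv.
Qed.

End Reflections.

(** The Weyl group is the full group of signed permutations: the roots 2 e_k supply the sign
    changes, the others the double transpositions of [signed_perm_ind]. *)
Lemma realized_long s : realized true s <-> (forall i, s (nu i) = nu (s i)).
Proof.
split=> [h i|]; first exact: realized_nu h.
move: s; apply: (signed_perm_ind chi_nuK chi_nu_fix_unique).
- exact: realized1.
- by move=> u s uu _; apply: realizedM; apply: realized_tperm.
by move=> u v s uu vv uv unv _; apply: realizedM; apply: realized_nu_tperm.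
Qed.

Lemma realized_short_even s : realized false s -> ~~ odd_perm s.
Proof.
move=> [w hw hs].
have [||||t ht hwt] := @in_weyl_permutes (signed_datum false n) m chi
    (fun s => ~~ odd_perm s) _ _ _ _ w hw.
- by rewrite odd_perm1.
- by move=> t t' /negPf ht /negPf ht'; rewrite odd_permM ht ht'.
- by move=> t; rewrite odd_permV.
- move=> p; have [u hu] := chi_onto (val p).1; have [v hv] := chi_onto (sneg (val p).2).
  have := signed_reflection_permutes hu hv; case: eqP => [e|_].
    by have := signed_index_valid p; rewrite e eqxx.
  by exists (nu_tperm nu u v) => //; rewrite odd_nu_tperm //; apply: chi_nuK.
by rewrite (@permutes_weights_perm_inj (signed_datum false n) m chi chi_inj w s t).
Qed.

Lemma realized_short_tperm2 u v : nu u != u -> nu v != v ->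
  realized false (tperm u (nu u) * tperm v (nu v))%g.
Proof.
move=> uu vv; have [->|uv] := eqVneq u v; first by rewrite tperm2; apply: realized1.
have [->|unv] := eqVneq u (nu v).
  by rewrite chi_nuK tpermC tperm2; apply: realized1.
rewrite (nu_tperm2 chi_nuK) //; apply: realizedM; apply: realized_nu_tperm => //.
  by rewrite chi_nuK eq_sym.
by rewrite chi_nuK.
Qed.

(* A sign change and the realized permutations generate all permutations
   commuting with [nu]; the parity then decides. *)
Lemma realized_short s : (0 < n)%N ->
  realized false s <-> (forall i, s (nu i) = nu (s i)) /\ ~~ odd_perm s.
Proof.
move=> n_gt0; split=> [h|[]].
  by split=> [i|]; [apply: realized_nu h | apply: realized_short_even].
have [u0 /signed_moved uu0] := chi_onto (Ordinal n_gt0, false).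
pose t0 := tperm u0 (nu u0).
suff h (s' : 'S_m) : (forall i, s' (nu i) = nu (s' i)) ->
    realized false s' \/ realized false (s' * t0)%g.
  move=> /h[]// /realized_short_even.
  by rewrite odd_permM odd_tperm eq_sym uu0 addbT negbK => ->.
move: s'; apply: (signed_perm_ind chi_nuK chi_nu_fix_unique).
- by left; apply: realized1.
(* Conjugation by s' turns the sign change of u into that of s' u, which can then be paired with
   [t0]. *)
- move=> u s' uu hs'; have sJ : (tperm u (nu u) * s' = s' * tperm (s' u) (nu (s' u)))%g.
    by rewrite -hs' -tpermJ conjgE !mulgA mulgV mul1g.
  have su : nu (s' u) != s' u by rewrite -hs' (inj_eq (@perm_inj _ s')).
  have tt := realized_short_tperm2 su uu0.
  case=> h; [right; rewrite sJ -mulgA | left; rewrite sJ]; first exact: realizedM.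
  have := realizedM h (realized_short_tperm2 uu0 su).
  by rewrite !mulgA -(mulgA s') tperm2 mulg1.
move=> u v s' uu vv uv unv _ [] h; [left | right; rewrite -mulgA];
  by apply: realizedM h; apply: realized_nu_tperm.
Qed.

Section Descriptions.
Variable R : realType.
Implicit Type y : 'I_m -> R.

(** The pairing depends on the datum only through its rank, so the statements for [Sp_datum] apply
    to both orthogonal data by conversion. *)
Lemma real_pairing_signed_weight (a : 'I_n * bool) (z : 'rV[R]_n) :
  @real_pairing R (Sp_datum n) (signed_weight a) z = (-1) ^+ a.2 * z 0 a.1.
Proof.
rewrite /real_pairing mxE (bigD1 a.1) //= big1 => [|k ka].
  by rewrite !mxE !eqxx mulr1 addr0 mulrC rmorph_sign.
by rewrite !mxE (negPf ka) mulr0 mulr0.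
Qed.

Lemma real_pairing_nu i (z : 'rV[R]_n) :
  @real_pairing R (Sp_datum n) (chi (nu i)) z = - @real_pairing R (Sp_datum n) (chi i) z.
Proof. by rewrite chi_nu /real_pairing map_mxN mulmxN mxE. Qed.

Lemma signed_nondegenerate (z : 'rV[R]_n) :
  (forall i, @real_pairing R (Sp_datum n) (chi i) z = 0) -> z = 0.
Proof.
move=> h; apply/rowP => k; have [i ik] := chi_onto (k, false).
by have := h i; rewrite ik real_pairing_signed_weight mul1r mxE.
Qed.

Lemma signed_diag_ex y : (forall i, y (nu i) = - y i) <->
  exists z, forall i, y i = @real_pairing R (Sp_datum n) (chi i) z.
Proof.
split=> [hy|[z hz] i]; last by rewrite !hz real_pairing_nu.
have /choice[idx hidx] := fun k => chi_onto (k, false).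
(* z is read off at the weights e_k; antisymmetry gives the values at - e_k, and y i = - y i at
   weight 0. *)
exists (\row_k y (idx k)) => i; have [i0|[[k b] ik]] := chi_signed i.
  rewrite i0 /real_pairing map_mx0 mulmx0 mxE.
  by have := hy i; rewrite ((chi_nu_fix i).2 i0); lra.
rewrite ik real_pairing_signed_weight mxE /=; case: b ik => ik.
  rewrite mulN1r -hy; congr y; apply: chi_inj.
  by rewrite ik chi_nu hidx -signed_weightN.
by rewrite mul1r; congr y; apply: chi_inj; rewrite ik hidx.
Qed.

Section Long.
Variable S : set (tropGL R m).
Hypothesis S_GLmon : forall y s, S (GLmon y s) <->
  (forall i, y (nu i) = - y i) /\ (forall i, s (nu i) = nu (s i)).

Lemma Sp_description : @matrix_description R (Sp_datum n) m chi S.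
Proof.
apply: (@weights_matrix_description (Sp_datum n)) => //.
- exact: signed_nondegenerate.
- exact: signed_reflection_ex.
by move=> y s; rewrite S_GLmon -realized_long signed_diag_ex.
Qed.

Lemma tr_signed_reflection long (p : signed_index long n) :
  (reflection_mx (signed_root p) (signed_coroot p))^T =
  reflection_mx (signed_root p) (signed_coroot p).
Proof.
rewrite /reflection_mx linearB /= trmx1 trmx_mul /signed_coroot /signed_root.
case: eqP => [->|_]; rewrite trmxK //.
by rewrite [(_ + _)^T]linearD /= mulmxDl mulmxDr.
Qed.

(** Coroots are proportional to transposed roots, so the reflections are symmetric matrices and the
    datum and its dual have the same Weyl group. *)
Lemma in_weyl_SO_odd (w : 'M[int]_n) :
  @in_weyl (SO_odd_datum n) w <-> @in_weyl (Sp_datum n) w.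
Proof.
have tr v : @in_weyl (Sp_datum n) v -> @in_weyl (Sp_datum n) v^T.
  elim=> {v} [|p|v v' _ hv _ hv'|v _ hv] /=.
  - by rewrite trmx1; apply: in_weyl1.
  - by rewrite tr_signed_reflection; apply: (@in_weyl_refl (Sp_datum n)).
  - by rewrite trmx_mul; apply: in_weylM.
  by rewrite trmx_inv; apply: in_weylV.
split=> [/in_weyl_dual/tr|/tr/dual_in_weyl h]; first by rewrite trmxK.
have := h (reduced_coroot (@signed_pairing2 true n) (@signed_pairing_le3 true n)).
by rewrite trmxK.
Qed.

Lemma SO_odd_description : @matrix_description R (SO_odd_datum n) m chi S.
Proof.
apply: (@weights_matrix_description (SO_odd_datum n)) => //.
- exact: signed_nondegenerate.
- move=> p; have [s hs] := @signed_reflection_ex true p; exists s.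
  by rewrite /= (@dual_reflection (Sp_datum n)) /= tr_signed_reflection.
move=> y s; rewrite S_GLmon -realized_long signed_diag_ex.
by split=> -[hy [w hw hs]]; split=> //; exists w => //; apply/in_weyl_SO_odd.
Qed.

End Long.

Lemma SO_even_description (S : set (tropGL R m)) : (0 < n)%N ->
    (forall y s, S (GLmon y s) <-> [/\ (forall i, y (nu i) = - y i),
      (forall i, s (nu i) = nu (s i)) & ~~ odd_perm s]) ->
  @matrix_description R (SO_even_datum n) m chi S.
Proof.
move=> n_gt0 S_GLmon; apply: (@weights_matrix_description (SO_even_datum n)) => //.
- exact: signed_nondegenerate.
- exact: signed_reflection_ex.
move=> y s; rewrite S_GLmon; have h := realized_short s n_gt0.
split=> [[/signed_diag_ex hy hs1 hs2]|[/signed_diag_ex hy /h[]]] //.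
by split=> //; apply/h.
Qed.

End Descriptions.
End SignedWeights.

(** * The symplectic and orthogonal groups *)

Section ClassicalGroups.
Variables (R : realType) (n : nat).

Definition even_nu (i : 'I_(n + n)) : 'I_(n + n) :=
  match fintype.split i with inl k => rshift n k | inr k => lshift n k end.

Definition odd_nu (i : 'I_(1 + (n + n))) : 'I_(1 + (n + n)) :=
  match fintype.split i with inl _ => i | inr j => rshift 1 (even_nu j) end.

Lemma even_nu_lshift k : even_nu (lshift n k) = rshift n k.
Proof. by rewrite /even_nu (unsplitK (inl k)). Qed.

Lemma even_nu_rshift k : even_nu (rshift n k) = lshift n k.
Proof. by rewrite /even_nu (unsplitK (inr k)). Qed.

Lemma odd_nu_rshift j : odd_nu (rshift 1 j) = rshift 1 (even_nu j).
Proof. by rewrite /odd_nu (unsplitK (inr j)). Qed.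

Lemma odd_nu_lshift k : odd_nu (lshift (n + n) k) = lshift (n + n) k.
Proof. by rewrite /odd_nu (unsplitK (inl k)). Qed.

Lemma even_weight_lshift k :
  even_coordinate_weight (lshift n k) = signed_weight (k, false).
Proof. by rewrite /even_coordinate_weight (unsplitK (inl k)). Qed.

Lemma even_weight_rshift k :
  even_coordinate_weight (rshift n k) = signed_weight (k, true).
Proof. by rewrite /even_coordinate_weight (unsplitK (inr k)). Qed.

Lemma odd_weight_rshift (j : 'I_(n + n)) :
  odd_coordinate_weight (rshift 1 j) = even_coordinate_weight j.
Proof. by rewrite /odd_coordinate_weight (unsplitK (inr j)). Qed.

Lemma odd_weight_lshift k : @odd_coordinate_weight n (lshift (n + n) k) = 0.
Proof. by rewrite /odd_coordinate_weight (unsplitK (inl k)). Qed.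

Lemma even_weight_ex (i : 'I_(n + n)) :
  exists a, even_coordinate_weight i = signed_weight a.
Proof.
case: (split_ordP i) => k ->; first by exists (k, false); rewrite even_weight_lshift.
by exists (k, true); rewrite even_weight_rshift.
Qed.

Lemma even_weight_inj : injective (@even_coordinate_weight n).
Proof.
move=> i j; case: (split_ordP i) => k ->; case: (split_ordP j) => l ->;
  by rewrite ?even_weight_lshift ?even_weight_rshift => /signed_weight_inj[] // ->.
Qed.

Lemma even_weight_nu i : even_coordinate_weight (even_nu i) = - even_coordinate_weight i.
Proof.
by case: (split_ordP i) => k ->;
  rewrite ?even_nu_lshift ?even_nu_rshift even_weight_lshift even_weight_rshift
    -signed_weightN.
Qed.

Lemma even_weight_onto a : exists i : 'I_(n + n), even_coordinate_weight i = signed_weight a.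
Proof.
case: a => k []; first by exists (rshift n k); rewrite even_weight_rshift.
by exists (lshift n k); rewrite even_weight_lshift.
Qed.

Lemma odd_weight_cases (i : 'I_(1 + (n + n))) : odd_coordinate_weight i = 0 \/
  exists a, odd_coordinate_weight i = signed_weight a.
Proof.
case: (split_ordP i) => k ->; first by left; rewrite odd_weight_lshift.
by right; rewrite odd_weight_rshift; apply: even_weight_ex.
Qed.

Lemma odd_weight_inj : injective (@odd_coordinate_weight n).
Proof.
move=> i j; case: (split_ordP i) => k ->; case: (split_ordP j) => l ->;
  rewrite ?odd_weight_lshift ?odd_weight_rshift.
- by rewrite !ord1.
- by have [a ->] := even_weight_ex l => /esym/signed_weight_neq0.
- by have [a ->] := even_weight_ex k => /signed_weight_neq0.
by move=> /even_weight_inj ->.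
Qed.

Lemma odd_weight_nu i : odd_coordinate_weight (odd_nu i) = - odd_coordinate_weight i.
Proof.
case: (split_ordP i) => k ->; first by rewrite odd_nu_lshift odd_weight_lshift oppr0.
by rewrite odd_nu_rshift !odd_weight_rshift even_weight_nu.
Qed.

Lemma odd_weight_onto a :
  exists i : 'I_(1 + (n + n)), odd_coordinate_weight i = signed_weight a.
Proof.
by have [i hi] := even_weight_onto a; exists (rshift 1 i); rewrite odd_weight_rshift.
Qed.

Lemma even_nuK : involutive even_nu.
Proof. exact: chi_nuK even_weight_inj even_weight_nu. Qed.

Lemma q_even_nu_form : @q_even R n = nu_form even_nu.
Proof.
apply/funext => x; rewrite /nu_form big_split_ord /=.
under eq_bigr do rewrite even_nu_lshift.
under [X in _ = _ + X]eq_bigr do rewrite even_nu_rshift mulrC.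
by rewrite tropDD.
Qed.

Lemma q_odd_nu_form : @q_odd R n = nu_form odd_nu.
Proof.
apply/funext => x; rewrite /nu_form big_split_ord big_ord1 odd_nu_lshift /= -expr2.
congr (_ + _); rewrite q_even_nu_form; apply: eq_bigr => i _.
by rewrite odd_nu_rshift !mxE.
Qed.

Lemma tropSp_GLmon y s : @tropSp R n (GLmon y s) <->
  (forall i, y (even_nu i) = - y i) /\ (forall i, s (even_nu i) = even_nu (s i)).
Proof.
have JE i j : @trop_J R n i j = (i == even_nu j)%:R.
  case: (split_ordP i) => k ->; case: (split_ordP j) => l ->;
    rewrite ?even_nu_lshift ?even_nu_rshift /trop_J.
  - by rewrite block_mxEul mxE eq_lrshift.
  - by rewrite block_mxEur mxE (inj_eq (@lshift_inj _ _)).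
  - by rewrite block_mxEdl mxE (inj_eq (@rshift_inj _ _)).
  by rewrite block_mxEdr mxE eq_rlshift.
(* Column i of D(y) P_s has its only finite entry, y (s i), in row s i. *)
have E i j : ((val (GLmon y s))^T *m @trop_J R n *m val (GLmon y s)) i j =
    trop (y (s i)) * trop (y (s j)) * (s i == even_nu (s j))%:R.
  rewrite mxE (bigD1 (s j)) //= [X in _ + X]big1 => [|k kj]; last first.
    by rewrite GLmonE (negPf kj) !mulr0.
  rewrite addr0 GLmonE eqxx mulr1 mxE (bigD1 (s i)) //= [X in _ + X]big1 => [|k ki].
    by rewrite addr0 mxE GLmonE eqxx mulr1 JE mulrAC.
  by rewrite mxE GLmonE (negPf ki) mulr0 mul0r.
split=> [h|[hy hs]]; last first.
  apply/matrixP => i j; rewrite E JE -hs (inj_eq (@perm_inj _ s)).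
  case: eqP => [->|_]; last by rewrite mulr0.
  by rewrite mulr1 hs hy; congr Some; rewrite addNr.
have {}h i j : trop (y (s i)) * trop (y (s j)) * (s i == even_nu (s j))%:R =
    (i == even_nu j)%:R by rewrite -E -JE h.
have hs i : s (even_nu i) = even_nu (s i).
  have := h (even_nu i) i; rewrite eqxx.
  by case: (s (even_nu i) =P even_nu (s i)); rewrite // mulr0.
split=> // i; have := h (even_nu (s^-1%g i)) (s^-1%g i).
rewrite hs permKV !eqxx mulr1 => -[e].
by apply/eqP; rewrite -addr_eq0 e.
Qed.

Lemma tropO_odd_GLmon y s : @tropO_odd R n (GLmon y s) <->
  (forall i, y (odd_nu i) = - y i) /\ (forall i, s (odd_nu i) = odd_nu (s i)).
Proof.
rewrite /tropO_odd q_odd_nu_form; apply: nu_form_stabilizer.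
  exact: chi_nuK odd_weight_inj odd_weight_nu.
exact: chi_nu_fix_unique odd_weight_inj odd_weight_nu.
Qed.

(** The tropical determinant of D(y) P_s does not see the sign of s; it is the sum of the y_i, which
    antisymmetry makes 0. *)
Lemma tropSO_odd_tropO_odd : @tropSO_odd R n = @tropO_odd R n.
Proof.
apply/seteqP; split=> A /=; first by case.
have [y [s ->]] := GLmon_ex A => h; split=> //; rewrite trop_det_GLmon.
have /tropO_odd_GLmon[hy _] := h; rewrite (sum_nu_anti _ hy) //.
exact: chi_nuK odd_weight_inj odd_weight_nu.
Qed.

Lemma tropSO_even_GLmon y s : @tropSO_even R n (GLmon y s) <->
  [/\ (forall i, y (even_nu i) = - y i), (forall i, s (even_nu i) = even_nu (s i))
    & ~~ odd_perm s].
Proof.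
have h : @tropO_even R n (GLmon y s) <-> (forall i, y (even_nu i) = - y i) /\
    (forall i, s (even_nu i) = even_nu (s i)).
  rewrite /tropO_even q_even_nu_form; apply: (nu_form_stabilizer even_nuK).
  exact: chi_nu_fix_unique even_weight_inj even_weight_nu.
split=> [[/h[hy hs] [y' [s' [/GLmon_inj[_ <-] so]]]]|[hy hs so]]; first by [].
by split; [apply/h | exists y, s].
Qed.

Lemma tropSp_description :
  @matrix_description R (Sp_datum n) (n + n) (@even_coordinate_weight n) (@tropSp R n).
Proof.
apply: Sp_description tropSp_GLmon; first exact: even_weight_inj.
- exact: even_weight_nu.
- by move=> i; right; apply: even_weight_ex.
exact: even_weight_onto.
Qed.

Lemma tropSO_odd_description : @matrix_description R (SO_odd_datum n) (1 + (n + n))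
  (@odd_coordinate_weight n) (@tropSO_odd R n).
Proof.
rewrite tropSO_odd_tropO_odd; apply: SO_odd_description tropO_odd_GLmon.
- exact: odd_weight_inj.
- exact: odd_weight_nu.
- exact: odd_weight_cases.
exact: odd_weight_onto.
Qed.

Lemma tropSO_even_description : (0 < n)%N ->
  @matrix_description R (SO_even_datum n) (n + n) (@even_coordinate_weight n)
    (@tropSO_even R n).
Proof.
move=> n_gt0; apply: SO_even_description tropSO_even_GLmon => //.
- exact: even_weight_inj.
- exact: even_weight_nu.
- by move=> i; right; apply: even_weight_ex.
exact: even_weight_onto.
Qed.

End ClassicalGroups.

(** * The group G_2 *)

Section G2.

(** Indices are zero-based natural numbers so that the finite checks can be run by evaluation. *)
Definition g2_monomials : seq (seq nat) :=
  [:: [:: 0; 2; 4]; [:: 1; 3; 5]; [:: 0; 3; 6]; [:: 1; 4; 6]; [:: 2; 5; 6]]%N.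

Definition g2_monomials_ord : seq (seq 'I_7) :=
  [seq [seq inord k | k <- l] | l <- g2_monomials].

Definition g2_weights : seq (int * int) :=
  [:: (1, 0); (2, 1); (1, 1); (-1, 0); (-2, -1); (-1, -1); (0, 0)].

Definition g2_refl (i : nat) (v : int * int) : int * int :=
  let: (r, c) := g2_pair i in let d := c.1 * v.1 + c.2 * v.2 in
  (v.1 - d * r.1, v.2 - d * r.2).

Definition g2_refl_list (i : nat) : seq nat :=
  [seq index (g2_refl i v) g2_weights | v <- g2_weights].

(** The images of the seven indices under a product of reflections; the last letter acts first. *)
Definition g2_word_list (ws : seq nat) : seq nat :=
  foldr (fun i q => [seq nth 0 (g2_refl_list i) k | k <- q]%N) (iota 0 7) ws.

(* Reduced words, in the reflections 0 and 1 in the simple roots a and b, of the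
   12 elements of the Weyl group. *)
Definition g2_words : seq (seq nat) :=
  [:: [::]; [:: 0]; [:: 1]; [:: 0; 1]; [:: 1; 0]; [:: 0; 1; 0]; [:: 1; 0; 1];
      [:: 0; 1; 0; 1]; [:: 1; 0; 1; 0]; [:: 0; 1; 0; 1; 0]; [:: 1; 0; 1; 0; 1];
      [:: 0; 1; 0; 1; 0; 1]]%N.

(** The condition on s in the conclusion of [trop_form_stabilizer], in computable form. *)
Definition g2_list_ok (p : seq nat) : bool :=
  all (fun l => has (fun l' => all (fun k => nth 0%N p k \in l) l') g2_monomials)
    g2_monomials.

Definition list_of_perm (p : seq nat) (s : 'S_7) := forall i : 'I_7, nth 0%N p i = s i.

Lemma g2_weightE i : g2_coordinate_weight i = (g2_vec (nth (0, 0) g2_weights i))^T.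
Proof. by []. Qed.

Lemma g2_monomials_lt7 l k : l \in g2_monomials -> k \in l -> (k < 7)%N.
Proof.
have /allP h : all (all (fun k => k < 7)%N) g2_monomials by [].
by move=> /h/allP/(_ k).
Qed.

Lemma mem_inord l (i : 'I_7) : l \in g2_monomials ->
  (i \in [seq inord k | k <- l]) = (nat_of_ord i \in l).
Proof.
move=> gl; rewrite -(mem_map val_inj) -map_comp map_id_in // => k lk /=.
by rewrite inordK // (g2_monomials_lt7 gl).
Qed.

Lemma g2_monomials_antichain l l' : l \in g2_monomials_ord ->
  l' \in g2_monomials_ord -> {subset l' <= l} -> perm_eq l' l.
Proof.
move=> /mapP[a ga ->] /mapP[b gb ->] sub.
have /allP/(_ _ ga)/allP/(_ _ gb) : all (fun a => all (fun b =>
    all (mem a) b ==> (b == a)) g2_monomials) g2_monomials by vm_compute.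
move=> /implyP h; suff /h/eqP-> : all (mem a) b by apply: perm_refl.
apply/allP => k bk; have k7 := g2_monomials_lt7 gb bk.
have := sub _ (map_f (fun k => inord k : 'I_7) bk).
by rewrite mem_inord // inordK.
Qed.

Lemma list_of_permE p s k : list_of_perm p s -> (k < 7)%N ->
  nth 0%N p k = s (inord k).
Proof. by move=> h k7; rewrite -h inordK. Qed.

Lemma list_of_perm_ex s : exists p, p \in permutations (iota 0 7) /\ list_of_perm p s.
Proof.
exists [seq nat_of_ord (s i) | i <- enum 'I_7]; split.
  rewrite mem_permutations; apply: uniq_perm; last first.
  - move=> k; rewrite mem_iota /=; apply/mapP/idP => [[i _ ->]|k7]; first exact: ltn_ord.
    by exists (s^-1%g (Ordinal k7)); rewrite ?mem_enum // permKV.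
  - exact: iota_uniq.
  by rewrite map_inj_uniq ?enum_uniq // => i j /val_inj/perm_inj.
by move=> i; rewrite (nth_map i) ?size_enum_ord ?nth_ord_enum.
Qed.

Lemma perm_of_list_ex p : perm_eq p (iota 0 7) -> exists s, list_of_perm p s.
Proof.
move=> hp; have sp : size p = 7 by rewrite (perm_size hp) size_iota.
have p7 (i : 'I_7) : (nth 0 p i < 7)%N.
  have : nth 0%N p i \in iota 0 7 by rewrite -(perm_mem hp) mem_nth // sp.
  by rewrite mem_iota.
have inj : injective (fun i : 'I_7 => Ordinal (p7 i)).
  move=> i j /(congr1 val)/= /eqP; rewrite nth_uniq ?sp ?(perm_uniq hp) ?iota_uniq //.
  by move=> /eqP/val_inj.
by exists (perm inj) => i; rewrite permE.
Qed.

(** The signs of root and coroot cancel, so only the six positive roots need checking. *)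
Lemma g2_reflection_vec (x : g2_index) v :
  reflection_mx (g2_root x) (g2_coroot x) *m (g2_vec v)^T = (g2_vec (g2_refl x.1 v))^T.
Proof.
rewrite /reflection_mx mulmxBl mul1mx /g2_root /g2_coroot -!scalemxAl -scalemxAr -scalemxAl.
rewrite scalerA -expr2 sqrr_sign scale1r -mulmxA /g2_refl.
case: (g2_pair x.1) => r c /=.
have -> : g2_vec c *m (g2_vec v)^T = (c.1 * v.1 + c.2 * v.2)%:M.
  by apply/matrixP => i j; rewrite !ord1 !mxE !big_ord_recl big_ord0 !mxE /= addr0.
by rewrite mul_mx_scalar; apply/colP => k; rewrite !mxE; case: ifP.
Qed.

Lemma g2_reflection_perm (x : g2_index) : exists s,
  [/\ list_of_perm (g2_refl_list x.1) s, preserves_monomials g2_monomials_ord s &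
    @permutes_weights G2_datum 7 g2_coordinate_weight
      (reflection_mx (g2_root x) (g2_coroot x)) s].
Proof.
have /allP/(_ x.1) : all (fun i => let p := g2_refl_list i in
    [&& perm_eq p (iota 0 7),
      all (fun l => has (fun l' => perm_eq (map (nth 0%N p) l') l) g2_monomials)
        g2_monomials &
      all (fun k => g2_refl i (nth (0, 0) g2_weights k) ==
        nth (0, 0) g2_weights (nth 0%N p k)) (iota 0 7)]) (iota 0 6) by vm_compute.
rewrite mem_iota ltn_ord => /(_ isT)/and3P[/perm_of_list_ex[s hs] /allP hl /allP hw].
exists s; split=> //.
  move=> _ /mapP[a /hl/hasP[b gb /(perm_map (fun k => inord k : 'I_7)) hb] ->].
  exists [seq inord k | k <- b]; first exact: map_f.
  apply: perm_trans hb; rewrite -map_comp -map_comp.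
  have /eq_in_map-> // : {in b, s \o inord =1 (fun k => inord k : 'I_7) \o nth 0%N (g2_refl_list x.1)}.
  by move=> k /(g2_monomials_lt7 gb) k7 /=; rewrite (list_of_permE hs k7) inord_val.
move=> i; rewrite !g2_weightE g2_reflection_vec -hs.
by have /hw/eqP-> : nat_of_ord i \in iota 0 7 by rewrite mem_iota ltn_ord.
Qed.

Definition g2_realized (s : 'S_7) := exists2 w, @in_weyl G2_datum w &
  @permutes_weights G2_datum 7 g2_coordinate_weight w s.

Lemma size_g2_word_list ws : size (g2_word_list ws) = 7.
Proof. by elim: ws => [|i ws IH] //=; rewrite size_map. Qed.

Lemma g2_word_realized ws : all (fun i => i < 6)%N ws ->
  exists2 s, g2_realized s & list_of_perm (g2_word_list ws) s.
Proof.
elim: ws => [_|i ws IH /= /andP[i6 /IH[s [w hw hs] sl]]].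
  exists 1%g; first by exists 1%:M; [apply: in_weyl1 | apply: permutes_weights1].
  by move=> i; rewrite perm1 nth_iota.
have [t [tl _ ht]] := g2_reflection_perm (Ordinal i6, false).
exists (s * t)%g.
  exists (reflection_mx (g2_root (Ordinal i6, false)) (g2_coroot (Ordinal i6, false)) *m w).
    by apply: in_weylM hw; apply: (@in_weyl_refl G2_datum).
  exact: permutes_weightsM.
by move=> k; rewrite permM -tl -sl (nth_map 0%N) // size_g2_word_list.
Qed.

(** The exhaustive search. The conditional, unlike a Boolean implication, delays the membership test
    until the first test has succeeded. *)
Lemma g2_permutations_ok : let words := [seq g2_word_list ws | ws <- g2_words] in
  all (fun p => if g2_list_ok p then p \in words else true) (permutations (iota 0 7)).
Proof. by vm_compute. Qed.

Lemma list_of_perm_inj p s t : list_of_perm p s -> list_of_perm p t -> s = t.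
Proof. by move=> hs ht; apply/permP => i; apply: val_inj; rewrite /= -hs -ht. Qed.

Lemma g2_realized_monomials (s : 'S_7) :
  (forall l, l \in g2_monomials_ord ->
    exists2 l', l' \in g2_monomials_ord & {subset map s l' <= l}) ->
  g2_realized s.
Proof.
move=> h; have [p [pp ps]] := list_of_perm_ex s.
have ok : g2_list_ok p.
  apply/allP => a ga; have [_ /mapP[b gb ->] sub] := h _ (map_f _ ga).
  apply/hasP; exists b => //; apply/allP => k bk.
  rewrite (list_of_permE ps (g2_monomials_lt7 gb bk)) -mem_inord //.
  by apply/sub/map_f/map_f.
have /allP/(_ _ pp) := g2_permutations_ok; rewrite ok => /mapP[ws gws pE].
have /allP/(_ _ gws)/g2_word_realized[t ht] : all (all (fun i => i < 6)%N) g2_words by [].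
by rewrite -pE => /(list_of_perm_inj ps)->.
Qed.

Lemma g2_weight_inj : injective g2_coordinate_weight.
Proof.
move=> i j; rewrite !g2_weightE => /trmx_inj/g2_vec_inj/eqP.
by rewrite nth_uniq // => /eqP/val_inj.
Qed.

(** Reflections preserve the monomials, hence so does the Weyl group; conversely, rearrangement
    implies the inclusion covered by the search. *)
Lemma g2_realizedP s : g2_realized s <-> preserves_monomials g2_monomials_ord s.
Proof.
split=> [[w hw hs]|h].
  have [|||p|t ht hwt] := @in_weyl_permutes G2_datum 7 g2_coordinate_weight
      (preserves_monomials g2_monomials_ord) _ _ _ _ w hw.
  - exact: preserves_monomials1.
  - exact: preserves_monomialsM.
  - exact: preserves_monomialsV.
  - by have [t [_ ht hwt]] := g2_reflection_perm p; exists t.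
  by rewrite (@permutes_weights_perm_inj G2_datum 7 _ g2_weight_inj w s t).
apply: g2_realized_monomials => l /h[l' gl' e]; exists l' => // k.
by rewrite (perm_mem e).
Qed.

Variable R : realType.

Lemma g2_cubic_trop_form : @g2_cubic R = @trop_form R 7 g2_monomials_ord.
Proof.
apply/funext => x; rewrite /trop_form /g2_monomials_ord /= !big_cons !big_nil.
by rewrite /g2_cubic /coord7 /= !mulr1 addr0 !addrA !mulrA.
Qed.

Lemma real_pairing_g2 (z : 'rV[R]_2) v :
  @real_pairing R G2_datum (g2_vec v)^T z = z 0 0 * v.1%:~R + z 0 1 * v.2%:~R.
Proof.
rewrite /real_pairing mxE !big_ord_recl big_ord0 addr0 !mxE /=.
by congr (z _ _ * _ + z _ _ * _); apply: val_inj.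
Qed.

Lemma g2_diag_ex (y : 'I_7 -> R) :
  (forall l, l \in g2_monomials_ord -> \sum_(i <- l) y i = 0) <->
  exists z, forall i, y i = @real_pairing R G2_datum (g2_coordinate_weight i) z.
Proof.
split=> [h|[z hz] _ /mapP[a ga ->]]; last first.
  rewrite big_map (eq_big_seq (fun k => z 0 0 * (nth (0, 0) g2_weights k).1%:~R +
      z 0 1 * (nth (0, 0) g2_weights k).2%:~R)) => [|k ak]; last first.
    by rewrite hz g2_weightE real_pairing_g2 inordK // (g2_monomials_lt7 ga).
  rewrite big_split -!mulr_sumr -!raddf_sum /=.
  have /allP/(_ _ ga)/eqP-> :
      all (fun a => \sum_(k <- a) nth (0, 0) g2_weights k == 0) g2_monomials.
    by rewrite /= !big_cons !big_nil.
  by rewrite !mulr0 addr0.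
have hM a : a \in g2_monomials -> \sum_(k <- a) y (inord k) = 0.
  by move=> ga; have := h _ (map_f _ ga); rewrite big_map.
have := hM [:: 0; 2; 4]%N isT; have := hM [:: 1; 3; 5]%N isT.
have := hM [:: 0; 3; 6]%N isT; have := hM [:: 1; 4; 6]%N isT.
have := hM [:: 2; 5; 6]%N isT; rewrite !big_cons !big_nil => e1 e2 e3 e4 e5.
(* x_1 and x_3 have weights a and a + b, which determines z. The three equations with y_7 minus the
   other two give 3 y_7 = 0, and then y_4, y_5, y_6 are the opposites of y_1, y_2, y_3. *)
exists (\row_j if j == 0 then y (inord 0) else y (inord 2) - y (inord 0)) => i.
rewrite g2_weightE real_pairing_g2 !mxE /= -{1}[i]inord_val.
by case: i => [[|[|[|[|[|[|[|//]]]]]]] hi] /=;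
  rewrite ?rmorphN ?rmorph_nat ?rmorph1 ?rmorph0 /=; lra.
Qed.

Lemma g2_nondegenerate (z : 'rV[R]_2) :
  (forall i, @real_pairing R G2_datum (g2_coordinate_weight i) z = 0) -> z = 0.
Proof.
move=> h; have z0 : z 0 0 = 0.
  by have := h (inord 0); rewrite g2_weightE real_pairing_g2 inordK //= mulr1 mulr0 addr0.
have := h (inord 1); rewrite g2_weightE real_pairing_g2 inordK //= z0 mul0r add0r mulr1 => z1.
apply/rowP => k; rewrite mxE; have [->|k1] := eqVneq k 0; first exact: z0.
by rewrite -z1; congr (z 0 _); apply: val_inj; case: k k1 => [[|[]]].
Qed.

Lemma tropG2_GLmon y s : @tropG2 R (GLmon y s) <->
  (forall l, l \in g2_monomials_ord -> \sum_(i <- l) y i = 0) /\ g2_realized s.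
Proof.
rewrite /tropG2 g2_cubic_trop_form; split=> [h|[hy /g2_realizedP]]; last first.
  exact: stabilizer_trop_form.
have {}h := trop_form_stabilizer g2_monomials_antichain h.
by split=> [l /h[]|] //; apply: g2_realized_monomials => l /h[].
Qed.

Lemma tropG2_description :
  @matrix_description R G2_datum 7 g2_coordinate_weight (@tropG2 R).
Proof.
apply: (@weights_matrix_description G2_datum).
- exact: g2_weight_inj.
- exact: g2_nondegenerate.
- by move=> p; have [s [_ _ hs]] := g2_reflection_perm p; exists s.
by move=> y s; rewrite tropG2_GLmon g2_diag_ex.
Qed.

End G2.

Theorem theorem0p1 (R : realType) (n : nat) (n_gt0 : (0 < n)%N) :
  [/\ @matrix_description R (SL_datum n) n (@sl_weight n) (@tropSL R n),
      @gcenter (tropGL R n) = @GLscalar R n /\ PGL_description R n,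
      @matrix_description R (Sp_datum n) (n + n)
        (@even_coordinate_weight n) (@tropSp R n)
    & [/\ @tropSO_odd R n = @tropO_odd R n
           /\ @matrix_description R (SO_odd_datum n) (1 + (n + n))
                (@odd_coordinate_weight n) (@tropSO_odd R n),
          @matrix_description R (SO_even_datum n) (n + n)
            (@even_coordinate_weight n) (@tropSO_even R n)
        & @matrix_description R G2_datum 7 g2_coordinate_weight (@tropG2 R)]].
Proof.
split; [exact: SL_matrix_description | | exact: tropSp_description | split].
- split; first exact: gcenter_tropGL.
  by case: n n_gt0 => // k _; apply: PGL_matrix_description.
- by split; [apply: tropSO_odd_tropO_odd | apply: tropSO_odd_description].
- exact: tropSO_even_description.
exact: tropG2_description.
Qed.
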